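(* Suppose $$G(w,\lambda)=e^{\phi(\lambda)}w+\sum_{n=0}^{\infty}u_{n+1}(\lambda)w^{-n}$$ (with $\phi$ real-valued and $\lambda$ a real parameter) is a solution of the radial L\''owner equation $$\frac{\partial G(w,\lambda)}{\partial\lambda}=-w\,\frac{\partial G(w,\lambda)}{\partial w}\,\frac{\sigma(\lambda)+w}{\sigma(\lambda)-w}\,\frac{\partial\phi(\lambda)}{\partial\lambda}$$ for some function $\sigma(\lambda)$ with $|\sigma(\lambda)|=1$, and let $$F(w,\lambda)=\frac{1}{\overline{G(1/\bar{w},\lambda)}}.$$ Let $g(z,\lambda)$ and $f(z,\lambda)$ be the inverse functions of $G(w,\lambda)$ and $F(w,\lambda)$ with respect to $w$, let $\Phi_n(w,\lambda)$ and $\Psi_n(w,\lambda)$, $n\ge1$, be the Faber polynomials of $g(z,\lambda)$ and $f(z,\lambda)$ respectively, and define $$\xi_n(\lambda)=\begin{cases}\sigma(\lambda)\,\Phi_n'(\sigma(\lambda),\lambda), & n\ge1,\\ 1,& n=0,\\ \sigma(\lambda)\,\Psi_{-n}'(\sigma(\lambda),\lambda),& n\le-1,\end{cases}$$ where $'$ denotes $\partial/\partial w$. Let $\boldsymbol{t}=\{t_n\}_{n\in\mathbb{Z}}$, where $t_0$ is a real-valued variable and, for $n\ne0$, the $t_n$ are complex variables such that $t_{-n}=-\bar{t}_n$, and let $\lambda(\boldsymbol{t})$ be a solution of $$\frac{\partial\lambda}{\partial t_n}=\xi_n(\lambda)\,\frac{\partial\lambda}{\partial t_0},\qquad n\in\mathbb{Z}.$$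 Then the pair $(\mathcal{L}(w;\boldsymbol{t}),\tilde{\mathcal{L}}(w;\boldsymbol{t}))$ defined by $$\mathcal{L}(w;\boldsymbol{t})=G(w,\lambda(\boldsymbol{t})),\qquad \tilde{\mathcal{L}}(w;\boldsymbol{t})=F(w,\lambda(\boldsymbol{t}))$$ is a solution of the dToda hierarchy with $t_{-n}=-\bar{t}_n$, $n\ge1$.
   Context: dToda hierarchy. Its unknowns are two formal power series in $w$, $$\mathcal{L}(w;\boldsymbol{t})=r(\boldsymbol{t})w+\sum_{n=0}^{\infty}u_{n+1}(\boldsymbol{t})w^{-n},\qquad \tilde{\mathcal{L}}^{-1}(w;\boldsymbol{t})=r(\boldsymbol{t})w^{-1}+\sum_{n=0}^{\infty}\tilde{u}_{n+1}(\boldsymbol{t})w^n,$$ where $\tilde{\mathcal L}^{-1}=1/\tilde{\mathcal L}$ is the reciprocal and the coefficients are (differentiable) functions of the variables $t_n$, $n\in\mathbb{Z}$, denoted collectively by $\boldsymbol{t}$. The pair is a solution of the dToda hierarchy if for all $n\ge1$ $$\frac{\partial\mathcal{L}}{\partial t_n}=\{\mathcal{B}_n,\mathcal{L}\}_T,\quad \frac{\partial\mathcal{L}}{\partial t_{-n}}=\{\tilde{\mathcal{B}}_n,\mathcal{L}\}_T,\quad \frac{\partial\tilde{\mathcal{L}}}{\partial t_n}=\{\mathcal{B}_n,\tilde{\mathcal{L}}\}_T,\quad \frac{\partial\tilde{\mathcal{L}}}{\partial t_{-n}}=\{\tilde{\mathcal{B}}_n,\tilde{\mathcal{L}}\}_T,$$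 where $$\mathcal{B}_n=(\mathcal{L}^n)_{>0}+\tfrac12(\mathcal{L}^n)_0,\qquad \tilde{\mathcal{B}}_n=(\tilde{\mathcal{L}}^{-n})_{<0}+\tfrac12(\tilde{\mathcal{L}}^{-n})_0,$$ $$\{h_1,h_2\}_T=w\frac{\partial h_1}{\partial w}\frac{\partial h_2}{\partial t_0}-w\frac{\partial h_1}{\partial t_0}\frac{\partial h_2}{\partial w},$$ and for $S\subset\mathbb{Z}$, $(\sum_kA_kw^k)_S=\sum_{k\in S}A_kw^k$ (subscripts $>0$, $0$, $<0$ denote the corresponding sets of exponents). When $t_{-n}=-\bar t_n$ for $n\ge1$, $\partial/\partial t_n$ is the Wirtinger derivative and $\partial/\partial t_{-n}=-\partial/\partial\bar t_n$. The function $\lambda(\boldsymbol{t})$ is real-valued. The series $G$ is a series near $w=\infty$ (with $\frac{\sigma+w}{\sigma-w}$ expanded in powers of $w^{-1}$), and $F$ is the series near $w=0$ with $F(w,\lambda)^{-1}=e^{\phi(\lambda)}w^{-1}+\sum_{n\ge0}\overline{u_{n+1}(\lambda)}\,w^n$. The inverses under composition are $g(z,\lambda)=e^{-\phi}z+O(1)$ near $z=\infty$ and $f(z,\lambda)=e^{\phi}z+O(z^2)$ near $z=0$. Faber polynomials. With $r=e^{\phi(\lambda)}$, $\Phi_n(w,\lambda)$ (polynomial in $w$) and $\Psi_n(w,\lambda)$ (polynomial in $w^{-1}$), $n\ge1$, are defined by $$\log\frac{g(z,\lambda)-w}{r^{-1}z}=-\sum_{n=1}^{\infty}\frac{\Phi_n(w,\lambda)}{n}z^{-n},\qquad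 \log\frac{w-f(z,\lambda)}{w}=\log\frac{f(z,\lambda)}{rz}-\sum_{n=1}^{\infty}\frac{\Psi_n(w,\lambda)}{n}z^n;$$ equivalently $\Phi_n=(G^n)_{\ge0}$ and $\Psi_n=(F^{-n})_{\le0}$. *)

(* Defs.v *)
From HB Require Import structures.
From mathcomp Require Import all_boot all_order all_algebra.
From mathcomp Require Import complex.
From mathcomp Require Import boolp classical_sets functions cardinality fsbigop.
From mathcomp Require Import reals topology normedtype sequences derive exp.

Set Implicit Arguments.
Unset Strict Implicit.
Unset Printing Implicit Defensive.
Import Order.TTheory GRing.Theory Num.Theory.
Import numFieldNormedType.Exports.

Local Open Scope classical_set_scope.
Local Open Scope complex_scope.
Local Open Scope ring_scope.

(** * Formal series *)

(* [a : fseries A] stands for the two-sided formal series whose coefficient of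
   w^k is [a k].  Series near w = oo and near w = 0 are those in [near_infty]
   and [near_zero].  Sums and opposites are the pointwise ones, but the
   product is [smul], not the pointwise [*%R] on functions.

   The infinite sums below are the finitely supported sums of [fsbigop], equal
   to 0 when the support is infinite.  In every use the support is finite: the
   factors of a product are both near oo, both near 0, or one of them is a
   Laurent polynomial. *)
Definition fseries (A : Type) := int -> A.

Section Series.
Variable A : comNzRingType.
Implicit Types a b : fseries A.

Definition near_infty : set (fseries A) :=
  [set a | exists N : int, forall k : int, N < k -> a k = 0].

Definition near_zero : set (fseries A) :=
  [set a | exists N : int, forall k : int, k < N -> a k = 0].

(* c w^n *)
Definition smonom (c : A) (n : int) : fseries A :=
  fun k => if k == n then c else 0.

Definition sone : fseries A := smonom 1 0.

Definition smul a b : fseries A :=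
  fun k => \sum_(i \in [set: int]) a i * b (k - i).

Definition spow a (n : nat) : fseries A := iter n (smul a) sone.

(* The reciprocal depends on the point of expansion, given by
   [S = near_infty] or [S = near_zero]. *)
Definition sinv (S : set (fseries A)) a : fseries A :=
  xget (0 : fseries A) [set b | S b /\ smul a b = sone].

Definition spowz (S : set (fseries A)) a (n : int) : fseries A :=
  match n with
  | Posz m => spow a m
  | Negz m => spow (sinv S a) m.+1
  end.

(* a(b(w)), the powers b^k with k < 0 being expanded according to S *)
Definition scomp (S : set (fseries A)) a b : fseries A :=
  fun m => \sum_(k \in [set: int]) a k * spowz S b k m.

(* d/dw *)
Definition sderiv a : fseries A := fun k => (k + 1)%:~R * a (k + 1).

(* w d/dw *)
Definition seuler a : fseries A := fun k => k%:~R * a k.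

(* (a)_S with S = [set k | P k] *)
Definition strunc (P : pred int) a : fseries A :=
  fun k => if P k then a k else 0.

End Series.

Arguments near_infty {A}.
Arguments near_zero {A}.
Arguments sone {A}.

Notation "a ** b" := (smul a b) (at level 40, left associativity).

(* Value at x of a Laurent polynomial. *)
Definition seval (K : fieldType) (a : fseries K) (x : K) : K :=
  \sum_(k \in [set: int]) a k * x ^ k.

(* log(1 + h) = sum_(k >= 1) (-1)^(k+1) h^k / k, for h = O(w^-1) or O(w). *)
Definition slog (K : fieldType) (A : comAlgType K) (a : fseries A) : fseries A :=
  fun m => \sum_(k \in [set k : nat | (0 < k)%N])
             ((-1) ^+ k.+1 / k%:R : K) *: spow (a - sone) k m.

Section Faber.
Variable K : fieldType.
Implicit Types (r : K) (a : fseries K).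

(* r w + sum_(n >= 0) u_(n+1) w^-n; the value [u 0] is not used. *)
Definition laurent r (u : nat -> K) : fseries K :=
  fun k => if k == 1 then r else if k <= 0 then u (absz k).+1 else 0.

Definition inverse_infty r a g :=
  [/\ g 1 = r^-1, forall k : int, 1 < k -> g k = 0,
      scomp near_infty a g = smonom 1 1 & scomp near_infty g a = smonom 1 1].

Definition inverse_zero r a f :=
  [/\ f 1 = r, forall k : int, k < 1 -> f k = 0,
      scomp near_zero a f = smonom 1 1 & scomp near_zero f a = smonom 1 1].

Definition slift a : fseries {poly K} := fun k => (a k)%:P.

(* sum_(n >= 1) p_n / n z^-n and sum_(n >= 1) p_n / n z^n *)
Definition log_coefs_infty (p : nat -> {poly K}) : fseries {poly K} :=
  fun k => if k < 0 then (absz k)%:R^-1 *: p (absz k) else 0.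
Definition log_coefs_zero (p : nat -> {poly K}) : fseries {poly K} :=
  fun k => if 0 < k then (absz k)%:R^-1 *: p (absz k) else 0.

(* log ((g(z) - w) / (r^-1 z)) = - sum_(n >= 1) Phi_n(w) / n z^-n, as series in
   z whose coefficients are polynomials in w = 'X. *)
Definition faber_infty r (g : fseries K) (Phi : nat -> {poly K}) :=
  slog (smonom r%:P (-1) ** (slift g - smonom 'X 0)) = - log_coefs_infty Phi.

(* log ((w - f(z)) / w) = log (f(z) / (r z)) - sum_(n >= 1) Psi_n(w) / n z^n, as
   series in z whose coefficients are polynomials in w^-1 = 'X; in particular
   (w - f(z)) / w = 1 - 'X f(z). *)
Definition faber_zero r (f : fseries K) (Psi : nat -> {poly K}) :=
  slog (sone - smonom 'X 0 ** slift f) =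
  slog (smonom (r^-1)%:P (-1) ** slift f) - log_coefs_zero Psi.

(* The Laurent polynomials p(w) and p(w^-1). *)
Definition poly_w (p : {poly K}) : fseries K :=
  fun k => if 0 <= k then p`_(absz k) else 0.
Definition poly_winv (p : {poly K}) : fseries K :=
  fun k => if k <= 0 then p`_(absz k) else 0.

Definition xi (s : K) (Phi Psi : nat -> {poly K}) (n : int) : K :=
  match n with
  | Posz 0 => 1
  | Posz m => s * seval (sderiv (poly_w (Phi m))) s
  | Negz m => s * seval (sderiv (poly_winv (Psi m.+1))) s
  end.

End Faber.

Section DToda.
Variable R : realType.
Local Notation C := R[i].

(** * Derivatives *)

Definition cderivable (h : R -> C) (x : R) :=
  derivable (fun s => complex.Re (h s)) x 1 /\
  derivable (fun s => complex.Im (h s)) x 1.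

Definition cderive (h : R -> C) (x : R) : C :=
  derive1 (fun s => complex.Re (h s)) x
  +i* derive1 (fun s => complex.Im (h s)) x.

(* The times are [t : int -> C] subject to t_0 real and t_(-n) = - conj t_n. *)
Definition real_times : set (int -> C) :=
  [set t | complex.Im (t 0) = 0 /\
           forall n : nat, (0 < n)%N -> t (- n%:Z) = - (t n%:Z)^*].

(* t_n becomes t_n + h and t_(-n) becomes t_(-n) - conj h; for n = 0 only used
   with h real.  This preserves [real_times]. *)
Definition tshift (t : int -> C) (n : int) (h : C) : int -> C :=
  fun k => if k == n then t k + h else if k == - n then t k - h^* else t k.

(* Partial derivatives in x and y, where t_n = x + i y. *)
Definition along_x (h : (int -> C) -> C) t n : R -> C :=
  fun s => h (tshift t n (s +i* 0)).
Definition along_y (h : (int -> C) -> C) t n : R -> C :=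
  fun s => h (tshift t n (0 +i* s)).
Definition dx n h t : C := cderive (along_x h t n) 0.
Definition dy n h t : C := cderive (along_y h t n) 0.

Definition tderivable (n : int) (h : (int -> C) -> C) t :=
  cderivable (along_x h t (absz n)) 0 /\
  (n != 0 -> cderivable (along_y h t (absz n)) 0).

(* d/dt_n: the real derivative in t_0 for n = 0, the Wirtinger derivative for
   n > 0, and - d/d(conj t_m) for n = - m < 0. *)
Definition tderive (n : int) (h : (int -> C) -> C) t : C :=
  match n with
  | Posz 0 => dx 0 h t
  | Posz m => (dx m h t - 'i * dy m h t) / 2
  | Negz m => - ((dx m.+1 h t + 'i * dy m.+1 h t) / 2)
  end.

Definition sderivable n (h : (int -> C) -> fseries C) t :=
  forall k, tderivable n (fun t' => h t' k) t.
Definition stderive n (h : (int -> C) -> fseries C) t : fseries C :=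
  fun k => tderive n (fun t' => h t' k) t.

(** * The dToda hierarchy *)

Definition toda_bracket (h1 h2 : (int -> C) -> fseries C) t : fseries C :=
  seuler (h1 t) ** stderive 0 h2 t - stderive 0 h1 t ** seuler (h2 t).

Definition toda_B (n : nat) (L : (int -> C) -> fseries C) t : fseries C :=
  strunc (fun k => 0 < k) (spow (L t) n)
  + 2^-1 *: strunc (fun k => k == 0) (spow (L t) n).

Definition toda_Bt (n : nat) (Lt : (int -> C) -> fseries C) t : fseries C :=
  strunc (fun k => k < 0) (spow (sinv near_zero (Lt t)) n)
  + 2^-1 *: strunc (fun k => k == 0) (spow (sinv near_zero (Lt t)) n).

(* Derivatives at points of U are those of functions defined on all
   [int -> C], so U need not be open.  [laurent] and its reflection k |-> - k
   give L = r w + u_1 + ... and 1 / Lt = r w^-1 + ut_1 + ut_2 w + ... *)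
Definition dtoda_solution (U : set (int -> C))
    (L Lt : (int -> C) -> fseries C) :=
  [/\ exists (r : (int -> C) -> C) (u ut : (int -> C) -> nat -> C),
        forall t, U t ->
        [/\ r t != 0, L t = laurent (r t) (u t), near_zero (Lt t) &
            sinv near_zero (Lt t) = (fun k => laurent (r t) (ut t) (- k))],
      forall t n, U t -> sderivable n L t /\ sderivable n Lt t &
      forall t (n : nat), U t -> (0 < n)%N ->
        [/\ stderive n%:Z L t = toda_bracket (toda_B n L) L t,
            stderive (- n%:Z) L t = toda_bracket (toda_Bt n Lt) L t,
            stderive n%:Z Lt t = toda_bracket (toda_B n L) Lt t &
            stderive (- n%:Z) Lt t = toda_bracket (toda_Bt n Lt) Lt t]].

(** * The radial Loewner equation *)

(* (s + w) / (s - w), expanded in powers of w^-1 *)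
Definition loewner_kernel (s : C) : fseries C :=
  (smonom s 0 + smonom 1 1) ** sinv near_infty (smonom s 0 - smonom 1 1).

Definition loewner_solution (I : set R) (phi : R -> R) (sigma : R -> C)
    (G : R -> fseries C) :=
  forall l, I l ->
    [/\ derivable phi l 1, forall k, cderivable (fun l' => G l' k) l &
        (fun k => cderive (fun l' => G l' k) l) =
        - ((derive1 phi l)%:C *: (seuler (G l) ** loewner_kernel (sigma l)))].

(* conj (a (1 / conj w)) *)
Definition sreflect (a : fseries C) : fseries C := fun k => (a (- k))^*.

End DToda.

(* Main.v *)
Require Import Defs.
From HB Require Import structures.
From mathcomp Require Import all_boot all_order all_algebra.
From mathcomp Require Import complex.
From mathcomp Require Import boolp classical_sets functions cardinality fsbigop.
From mathcomp Require Import reals topology normedtype sequences derive exp.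
From mathcomp Require Import zify ring.

(** All times act through the single function lambda, so every equation of the
    hierarchy reduces to an identity between series in w at a fixed parameter
    value.  Write D for w d/dw, p for the derivative of phi and s for sigma.
    The Loewner equation for G reads (1 - s/w) G_lambda = p (1 + s/w) D G, and
    so does the one for any power of G.  The Hamiltonian B_n, a truncation of
    G^n, then satisfies (1 - s/w) B_lambda = p (1 + s/w) (D B - x) with the
    constant x = sum_(m > 0) m a_m s^m, where a_m are the coefficients of G^n
    ([loewner_upper]).  Multiplying by (1 - s/w) one sees that
    (D B) G_lambda - B_lambda (D G) = x G_lambda ([loewner_bracket_infty]), which
    is the Toda equation in t_n as soon as x is the velocity xi_n of lambda.

    This relation with denominators cleared is preserved by w |-> 1 / conj w
    because |s| = 1.  Hence F, as well as the Hamiltonians of the times t_(-n),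
    satisfy it with the same s, and the other three families of equations
    follow from the same computation ([loewner_bracket_zero] near w = 0).

    It remains to identify xi_n with x, that is to see that the Faber
    polynomials are Phi_n = (G^n)_(>=0) and Psi_n = (F^-n)_(<=0).  Their
    definition by a logarithm is differentiated ([slog_euler]), composed with G,
    and the coefficient of z^-n is extracted by means of the invariance of the
    residue under the change of variable z = G(w) ([residue_comp],
    [faber_core]).

    Series near 0 are reflected to series at infinity, so that one ring,
    [linf], serves for all computations. *)

Set Implicit Arguments.
Unset Strict Implicit.
Unset Printing Implicit Defensive.
Import Order.TTheory GRing.Theory Num.Theory.
Import numFieldNormedType.Exports.

Local Open Scope classical_set_scope.
Local Open Scope complex_scope.
Local Open Scope ring_scope.

(** * The ring of Laurent series at infinity *)

Definition deg_le (A : comNzRingType) (N : int) (a : fseries A) : Prop :=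
  forall k : int, N < k -> a k = 0.

Lemma fsum_window (A : comNzRingType) (N : int) (n : nat) (F : int -> A) :
  (forall i, (i <= N - n%:Z) || (N < i) -> F i = 0) ->
  \sum_(i \in [set: int]) F i = \sum_(i < n) F (N - i%:Z).
Proof.
move=> F0; rewrite (fsbigE [seq N - i%:Z | i <- iota 0 n]) //.
- rewrite big_map /= (eq_bigl predT); last by move=> i; rewrite in_setT.
  have -> : iota 0 n = index_iota 0 n by rewrite /index_iota subn0.
  exact: big_mkord.
- by rewrite map_inj_uniq ?iota_uniq // => i j; lia.
- move=> i _ ni; apply: F0; move: ni; apply: contraR => hi.
  by apply/mapP; exists (absz (N - i)); rewrite ?mem_iota; lia.
Qed.

Lemma fsum_delta (A : comNzRingType) (N : int) (F : int -> A) :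
  (forall i, i != N -> F i = 0) -> \sum_(i \in [set: int]) F i = F N.
Proof.
move=> F0; rewrite (fsum_window (N := N) (n := 1)); last by move=> i Hi; apply: F0; lia.
by rewrite big_ord_recl big_ord0 addr0 subr0.
Qed.

Section RawProduct.
Variable A : comNzRingType.
Implicit Types (a b c : fseries A) (N M : int).

Lemma deg_leW N M a : N <= M -> deg_le N a -> deg_le M a.
Proof. by move=> NM Na k Mk; apply: Na; lia. Qed.

Lemma smul_degE N M n a b : deg_le N a -> deg_le M b ->
  (a ** b) (N + M - n%:Z) = \sum_(i < n.+1) a (N - i%:Z) * b (M - (n - i)%N%:Z).
Proof.
move=> Na Mb; rewrite /smul (fsum_window (N := N) (n := n.+1)) => [|i Hi].
  apply: eq_bigr => i _; congr (_ * b _).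
  by have := ltn_ord i; lia.
by case: (ltrP N i) => Ni; [rewrite Na ?mul0r | rewrite Mb ?mulr0 //; lia].
Qed.

Lemma deg_leM N M a b : deg_le N a -> deg_le M b -> deg_le (N + M) (a ** b).
Proof.
move=> Na Mb k NMk; rewrite /smul fsbig1 // => i _.
by case: (ltrP N i) => Ni; [rewrite Na ?mul0r | rewrite Mb ?mulr0 //; lia].
Qed.

Lemma smul_lead N M a b : deg_le N a -> deg_le M b ->
  (a ** b) (N + M) = a N * b M.
Proof.
move=> Na Mb; have := smul_degE 0 Na Mb.
by rewrite big_ord_recl big_ord0 !subr0 addr0.
Qed.

(** The product of series of bounded degree is, coefficient by coefficient, a
    product of polynomials; the ring axioms below are inherited from there. *)
Definition trunc_poly (n : nat) (N : int) a : {poly A} :=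
  \poly_(i < n) a (N - i%:Z).

Lemma smul_poly N M n k a b : deg_le N a -> deg_le M b -> (k < n)%N ->
  (a ** b) (N + M - k%:Z) = (trunc_poly n N a * trunc_poly n M b)`_k.
Proof.
move=> Na Mb kn; rewrite smul_degE // coefM; apply: eq_bigr => i _.
by rewrite !coef_poly !ifT //; have := ltn_ord i; lia.
Qed.

Lemma degP N k : (exists n : nat, k = N - n%:Z) \/ N < k.
Proof. by case: (ltrP N k) => H; [right | left; exists (absz (N - k)); lia]. Qed.

Lemma smulC N M a b : deg_le N a -> deg_le M b -> a ** b = b ** a.
Proof.
move=> Na Mb; apply/funext => k.
have [[n ->]|H] := degP (N + M) k.
  rewrite (smul_poly Na Mb (ltnSn n)) mulrC -smul_poly // 1?[M + N]addrC //.
by rewrite (deg_leM Na Mb) ?(deg_leM Mb Na) //; lia.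
Qed.

Lemma smulA N M Q a b c : deg_le N a -> deg_le M b -> deg_le Q c ->
  a ** (b ** c) = a ** b ** c.
Proof.
move=> Na Mb Qc; apply/funext => k.
have Nab := deg_leM Na Mb; have Nbc := deg_leM Mb Qc.
have [[n ->]|H] := degP (N + M + Q) k; last first.
  by rewrite (deg_leM Na Nbc) ?(deg_leM Nab Qc) //; lia.
rewrite (smul_degE _ Nab Qc) -(addrA N M Q) (smul_degE _ Na Nbc).
transitivity ((trunc_poly n.+1 N a * (trunc_poly n.+1 M b * trunc_poly n.+1 Q c))`_n).
  rewrite coefM; apply: eq_bigr => i _.
  rewrite (smul_poly Mb Qc (n := n.+1)) ?coef_poly ?ltn_ord //.
  by have := ltn_ord i; lia.
rewrite mulrA coefM; apply: eq_bigr => i _.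
rewrite (smul_poly Na Mb (n := n.+1)) ?coef_poly ?ifT //;
  by have := ltn_ord i; lia.
Qed.

Lemma smulDl N M a b c : deg_le N a -> deg_le N b -> deg_le M c ->
  (a + b : fseries A) ** c = a ** c + b ** c.
Proof.
move=> Na Nb Mc; apply/funext => k.
have Nab : deg_le N (a + b : fseries A).
  by move=> i Hi; rewrite fctE Na ?Nb ?addr0.
rewrite -[RHS]/((a ** c) k + (b ** c) k); have [[n ->]|H] := degP (N + M) k; last first.
  by rewrite (deg_leM Na Mc) ?(deg_leM Nb Mc) ?(deg_leM Nab Mc) ?addr0 //; lia.
rewrite !smul_degE // -big_split; apply: eq_bigr => i _.
by rewrite fctE mulrDl.
Qed.

Lemma smul_monoml (x : A) n b k : (smonom x n ** b) k = x * b (k - n).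
Proof.
rewrite /smul (fsum_delta (N := n)) => [|i Hi].
  by rewrite /smonom eqxx.
by rewrite /smonom (negPf Hi) mul0r.
Qed.

Lemma smul1 b : sone ** b = b.
Proof. by apply/funext => k; rewrite smul_monoml mul1r subr0. Qed.

Lemma deg_le_monom (x : A) n : deg_le n (smonom x n).
Proof. by move=> k nk; rewrite /smonom ifF //; lia. Qed.

End RawProduct.

(** The ring in which all computations take place.  Membership is a boolean so
    that equality of the underlying series gives equality in the ring. *)
Record linf (A : comNzRingType) :=
  Linf { lval : fseries A; linf_subproof : `[< near_infty lval >] }.

HB.instance Definition _ (A : comNzRingType) := [isSub for @lval A].
HB.instance Definition _ (A : comNzRingType) :=
  [Choice of linf A by <:].

Lemma lvalP (A : comNzRingType) (a : linf A) : exists N, deg_le N (lval a).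
Proof. exact/asboolP/(valP a). Qed.

Lemma linfE (A : comNzRingType) (a b : linf A) :
  (forall k, lval a k = lval b k) -> a = b.
Proof. by move=> ab; apply/val_inj/funext. Qed.

Section LinfRing.
Variable A : comNzRingType.
Implicit Types a b : linf A.

Definition mk (a : fseries A) (N : int) (h : deg_le N a) : linf A :=
  Linf (asboolT (ex_intro _ N h)).

Lemma lvalP2 a b : exists N, deg_le N (lval a) /\ deg_le N (lval b).
Proof.
have [N Na] := lvalP a; have [M Mb] := lvalP b.
by exists (Num.max N M); split; [apply: deg_leW Na | apply: deg_leW Mb];
  rewrite le_max lexx ?orbT.
Qed.

Fact linf_add_subproof a b : `[< near_infty (lval a + lval b) >].
Proof.
apply/asboolP; have [N [Na Nb]] := lvalP2 a b.
by exists N => k Nk; rewrite fctE Na ?Nb ?addr0.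
Qed.
Fact linf_opp_subproof a : `[< near_infty (- lval a) >].
Proof.
by apply/asboolP; have [N Na] := lvalP a; exists N => k Nk; rewrite fctE Na ?oppr0.
Qed.
Fact linf_mul_subproof a b : `[< near_infty (lval a ** lval b) >].
Proof.
apply/asboolP; have [N Na] := lvalP a; have [M Mb] := lvalP b.
by exists (N + M); apply: deg_leM.
Qed.
Fact linf_zero_subproof : `[< near_infty (0 : fseries A) >].
Proof. by apply/asboolP; exists 0. Qed.

Definition mono (c : A) (n : int) : linf A := mk (@deg_le_monom A c n).
Definition linf_add a b := Linf (linf_add_subproof a b).
Definition linf_opp a := Linf (linf_opp_subproof a).
Definition linf_mul a b := Linf (linf_mul_subproof a b).
Definition linf_zero := Linf linf_zero_subproof.

Fact linf_addA : associative linf_add.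
Proof. by move=> a b c; apply: val_inj; rewrite /= addrA. Qed.
Fact linf_addC : commutative linf_add.
Proof. by move=> a b; apply: val_inj; rewrite /= addrC. Qed.
Fact linf_add0 : left_id linf_zero linf_add.
Proof. by move=> a; apply: val_inj; rewrite /= add0r. Qed.
Fact linf_addN : left_inverse linf_zero linf_opp linf_add.
Proof. by move=> a; apply: val_inj; rewrite /= addNr. Qed.

HB.instance Definition _ :=
  GRing.isZmodule.Build (linf A) linf_addA linf_addC linf_add0 linf_addN.

Fact linf_mulA : associative linf_mul.
Proof.
move=> a b c; have [N Na] := lvalP a; have [M [Mb Mc]] := lvalP2 b c.
exact/val_inj/(smulA Na Mb Mc).
Qed.
Fact linf_mulC : commutative linf_mul.
Proof. by move=> a b; have [N [Na Nb]] := lvalP2 a b; exact/val_inj/(smulC Na Nb). Qed.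
Fact linf_mul1 : left_id (mono 1 0) linf_mul.
Proof. by move=> a; apply/val_inj/smul1. Qed.
Fact linf_mulDl : left_distributive linf_mul +%R.
Proof.
move=> a b c; have [N [Na Nb]] := lvalP2 a b; have [M Mc] := lvalP c.
exact/val_inj/(smulDl Na Nb Mc).
Qed.
Fact linf_1_neq0 : mono 1 0 != 0.
Proof.
apply/eqP => /(congr1 (fun a : linf A => lval a 0)) /=.
by rewrite /smonom eqxx; apply/eqP/oner_neq0.
Qed.

HB.instance Definition _ := GRing.Zmodule_isComNzRing.Build (linf A)
  linf_mulA linf_mulC linf_mul1 linf_mulDl linf_1_neq0.

Lemma lvalD a b k : lval (a + b) k = lval a k + lval b k. Proof. by []. Qed.
Lemma lvalN a k : lval (- a) k = - lval a k. Proof. by []. Qed.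
Lemma lvalB a b k : lval (a - b) k = lval a k - lval b k. Proof. by []. Qed.
Lemma lval1 : lval (1 : linf A) = sone. Proof. by []. Qed.
Lemma lvalM a b : lval (a * b) = lval a ** lval b. Proof. by []. Qed.
Lemma lval_mono c n k : lval (mono c n) k = if k == n then c else 0.
Proof. by []. Qed.
Lemma lvalX a n : lval (a ^+ n) = spow (lval a) n.
Proof. by elim: n => // n IH; rewrite exprS lvalM IH. Qed.
Lemma lval_sum (I : Type) (r : seq I) (P : pred I) (F : I -> linf A) k :
  lval (\sum_(i <- r | P i) F i) k = \sum_(i <- r | P i) lval (F i) k.
Proof. exact: (big_morph (fun a : linf A => lval a k)). Qed.
Lemma lval_monoM c n a k : lval (mono c n * a) k = c * lval a (k - n).
Proof. exact: smul_monoml. Qed.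

Lemma monoM c d m n : mono c m * mono d n = mono (c * d) (m + n).
Proof.
apply: linfE => k; rewrite lval_monoM !lval_mono.
by rewrite subr_eq [n + m]addrC; case: eqP => _; rewrite ?mulr0.
Qed.
Lemma mono0 n : mono 0 n = 0.
Proof. by apply: linfE => k; rewrite lval_mono if_same. Qed.
Lemma mono1 : mono 1 0 = 1. Proof. by []. Qed.
Lemma monoD c d n : mono (c + d) n = mono c n + mono d n.
Proof.
by apply: linfE => k; rewrite lvalD !lval_mono; case: eqP => _; rewrite ?addr0.
Qed.
Lemma monoN c n : mono (- c) n = - mono c n.
Proof.
by apply: linfE => k; rewrite lvalN !lval_mono; case: eqP => _; rewrite ?oppr0.
Qed.

Lemma degD N a b : deg_le N (lval a) -> deg_le N (lval b) -> deg_le N (lval (a + b)).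
Proof. by move=> Na Nb k Nk; rewrite lvalD Na ?Nb ?addr0. Qed.
Lemma degN N a : deg_le N (lval a) -> deg_le N (lval (- a)).
Proof. by move=> Na k Nk; rewrite lvalN Na ?oppr0. Qed.
Lemma degM N M a b : deg_le N (lval a) -> deg_le M (lval b) ->
  deg_le (N + M) (lval (a * b)).
Proof. exact: deg_leM. Qed.
Lemma deg1 : deg_le 0 (lval (1 : linf A)).
Proof. exact: deg_le_monom. Qed.
Lemma degX N a n : deg_le N (lval a) -> deg_le (N * n%:Z) (lval (a ^+ n)).
Proof.
move=> Na; elim: n => [|n IH]; first by rewrite mulr0; exact: deg1.
by rewrite exprS intS mulrDr mulr1; exact: degM.
Qed.
Lemma lval_lead N M a b : deg_le N (lval a) -> deg_le M (lval b) ->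
  lval (a * b) (N + M) = lval a N * lval b M.
Proof. exact: smul_lead. Qed.

Lemma deg_euler N (a : fseries A) : deg_le N a -> deg_le N (seuler a).
Proof. by move=> Na k Nk; rewrite /seuler Na ?mulr0. Qed.

Fact euler_subproof a : `[< near_infty (seuler (lval a)) >].
Proof.
by apply/asboolP; have [N Na] := lvalP a; exists N; apply: deg_euler.
Qed.
Definition euler a : linf A := Linf (euler_subproof a).

Lemma lval_euler a k : lval (euler a) k = k%:~R * lval a k. Proof. by []. Qed.
Lemma eulerD a b : euler (a + b) = euler a + euler b.
Proof. by apply: linfE => k; rewrite lvalD !lval_euler lvalD mulrDr. Qed.
Lemma eulerN a : euler (- a) = - euler a.
Proof. by apply: linfE => k; rewrite lvalN !lval_euler lvalN mulrN. Qed.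
Lemma euler_mono c n : euler (mono c n) = mono (n%:~R * c) n.
Proof.
apply: linfE => k; rewrite lval_euler !lval_mono.
by case: eqP => [->|_] //; rewrite mulr0.
Qed.
Lemma euler_const c : euler (mono c 0) = 0.
Proof.
by rewrite euler_mono mul0r; apply: linfE => k; rewrite lval_mono if_same.
Qed.
Lemma euler0 : euler 0 = 0.
Proof. by apply: linfE => k; rewrite lval_euler mulr0. Qed.
Lemma euler1 : euler 1 = 0. Proof. exact: euler_const. Qed.

Lemma eulerM a b : euler (a * b) = euler a * b + a * euler b.
Proof.
have [N Na] := lvalP a; have [M Mb] := lvalP b.
have NEa := deg_euler Na; have MEb := deg_euler Mb.
apply: linfE => k; rewrite lval_euler lvalD !lvalM.
have [[n ->]|H] := degP (N + M) k; last first.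
  by rewrite (deg_leM Na Mb) ?(deg_leM NEa Mb) ?(deg_leM Na MEb) ?mulr0 ?addr0.
rewrite !smul_degE // mulr_sumr -big_split; apply: eq_bigr => i _ /=.
have -> : N + M - n%:Z = (N - i%:Z) + (M - (n - i)%N%:Z).
  by have := ltn_ord i; lia.
by rewrite /seuler; rewrite intrD; ring.
Qed.

Lemma eulerX a n : euler (a ^+ n.+1) = n.+1%:R * a ^+ n * euler a.
Proof.
elim: n => [|n IH]; first by rewrite expr1 expr0 !mul1r.
by rewrite exprS eulerM IH exprS [n.+2%:R]mulrS; ring.
Qed.

End LinfRing.

(** * Limits, inverses and composition *)

Section Limits.
Variable A : comNzRingType.
Implicit Types a b : linf A.

Lemma eq_approx a b : (forall n : nat, deg_le (- n%:Z) (lval (a - b))) -> a = b.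
Proof.
move=> ab; apply: linfE => k; apply/eqP; rewrite -subr_eq0 -lvalB; apply/eqP.
by apply: (ab (absz k).+1); lia.
Qed.

(** Every series is a limit of finite sums of monomials, so an additive
    functional that depends on finitely many of the leading coefficients is
    determined by its values at the monomials. *)
Lemma additive_eq0 (D : linf A -> A) :
  (forall a b, D (a + b) = D a + D b) -> (forall c k, D (mono c k) = 0) ->
  (exists N, forall a, deg_le N (lval a) -> D a = 0) -> forall a, D a = 0.
Proof.
move=> DD Dm [N DN] a; have [M Ma] := lvalP a.
have peel n : exists2 a', deg_le (M - n%:Z) (lval a') & D a = D a'.
  elim: n => [|n [a' Ma' Daa']]; first by exists a; rewrite ?subr0.
  set m := mono (lval a' (M - n%:Z)) (M - n%:Z).
  exists (a' - m); last by rewrite Daa' -[in LHS](subrK m a') (DD (a' - m)) (Dm _ _ : D m = 0) addr0.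
  move=> k Hk; rewrite lvalB lval_mono; case: eqP => [->|ne]; first by rewrite subrr.
  by rewrite Ma' ?subrr //; lia.
have [a' Ma' ->] := peel (absz (M - N)).
by apply: DN; apply: deg_leW Ma'; lia.
Qed.

(** Completeness: when consecutive terms agree in ever more coefficients, each
    coefficient is eventually constant. *)
Lemma limit_exists (S : nat -> linf A) :
  (forall n, deg_le (- n%:Z) (lval (S n.+1 - S n))) ->
  exists L : linf A, forall n, deg_le (- n%:Z) (lval (L - S n)).
Proof.
move=> Sn; have stable n m k : (n <= m)%N -> - n%:Z < k -> lval (S m) k = lval (S n) k.
  move=> nm nk; elim: m nm => [|m IH]; first by rewrite leqn0 => /eqP ->.
  rewrite leq_eqVlt => /predU1P[-> //|]; rewrite ltnS => nm; rewrite -IH //.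
  by apply/eqP; rewrite -subr_eq0 -lvalB Sn //; lia.
have [N N0] := lvalP (S 0%N).
pose s k := lval (S (absz k).+1) k.
have Ns : deg_le (Num.max N 0) s.
  move=> k; rewrite gt_max => /andP[Nk k0].
  by rewrite /s (stable 0%N) ?N0 //; lia.
exists (mk Ns) => n k nk; rewrite lvalB /= /s.
case: (leqP n (absz k).+1) => H; first by rewrite (stable n) ?subrr.
by rewrite -(stable (absz k).+1 n k) ?subrr //; lia.
Qed.

(** The geometric series in [h] converges because [h] has negative degree. *)
Lemma one_sub_inv h : deg_le (-1) (lval h) ->
  exists s : linf A, s * (1 - h) = 1 /\ deg_le 0 (lval s).
Proof.
move=> h1; pose S n : linf A := \sum_(i < n) h ^+ i.
have hX n : deg_le (- n%:Z) (lval (h ^+ n)).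
  by have := degX (n := n) h1; rewrite mulN1r.
have [s Ss] : exists s : linf A, forall n, deg_le (- n%:Z) (lval (s - S n)).
  by apply: limit_exists => n; rewrite /S big_ord_recr addrC addKr.
exists s; split; last by have := Ss 0%N; rewrite /S big_ord0 subr0 oppr0.
apply: eq_approx => n.
have Sn : S n * (1 - h) = 1 - h ^+ n.
  by rewrite -[RHS]opprB subrX1 /S; ring.
have -> : s * (1 - h) - 1 = (s - S n) * (1 - h) - h ^+ n.
  by rewrite mulrBl Sn; ring.
apply: degD; last exact: degN.
rewrite -[- n%:Z]addr0; apply: degM => //.
by apply: degD; [exact: deg1 | apply/degN/(deg_leW _ h1)].
Qed.

(** Dividing by the leading monomial reduces to [one_sub_inv]. *)
Lemma inv_exists a N c : deg_le N (lval a) -> c * lval a N = 1 ->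
  exists b : linf A, a * b = 1 /\ deg_le (- N) (lval b).
Proof.
move=> Na ca; pose h := 1 - mono c (- N) * a.
have h1 : deg_le (-1) (lval h).
  move=> k Hk; rewrite /h lvalB lval_monoM opprK lval1 /sone /smonom.
  case: eqP => [->|ne]; first by rewrite add0r ca subrr.
  by rewrite Na ?mulr0 ?subr0 //; lia.
have [s [sh s0]] := one_sub_inv h1.
exists (mono c (- N) * s); split; first by rewrite -sh /h; ring.
have dm : deg_le (- N) (lval (mono c (- N))) by exact: deg_le_monom.
by have := degM dm s0; rewrite addr0.
Qed.

Lemma sinv_unique a b : a * b = 1 -> sinv near_infty (lval a) = lval b.
Proof.
move=> ab; apply: xget_unique => [|c [nc ac]].
  by split; [exact: lvalP | rewrite -lvalM ab].
pose y : linf A := Linf (asboolT nc).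
have ay : a * y = 1 by apply: val_inj; exact: ac.
by rewrite -[c]/(lval y) -[y]mulr1 -ab mulrCA mulrA ay mul1r.
Qed.

End Limits.

Section Composition.
Variable A : comNzRingType.
Variables G H : linf A.
Hypotheses (GH : G * H = 1).
Hypotheses (degG : deg_le 1 (lval G)) (degH : deg_le (-1) (lval H)).
Implicit Types a b : linf A.

Lemma mono_natr n : mono n%:R 0 = n%:R :> linf A.
Proof.
elim: n => [|n IH]; first by apply: linfE => k; rewrite lval_mono if_same.
by rewrite !mulrS monoD IH.
Qed.

Lemma mono_intr (k : int) : mono k%:~R 0 = k%:~R :> linf A.
Proof.
case: k => n; first exact: mono_natr.
by rewrite NegzE !mulrNz monoN mono_natr.
Qed.

(** An explicit inverse [H] of [G] stands for the chosen reciprocal [sinv], so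
    that exponents can be computed with. *)
Definition zpow (k : int) : linf A :=
  match k with Posz n => G ^+ n | Negz n => H ^+ n.+1 end.

Lemma spowz_zpow k : spowz near_infty (lval G) k = lval (zpow k).
Proof. by case: k => n; rewrite /zpow lvalX // -(sinv_unique GH). Qed.

Lemma zpowB (m n : nat) : zpow (m%:Z - n%:Z) = G ^+ m * H ^+ n.
Proof.
have GHn p : G ^+ p * H ^+ p = 1 by rewrite -exprMn GH expr1n.
case: (leqP n m) => nm.
  rewrite subzn //= -{2}(subnK nm) exprD -mulrA GHn mulr1 //.
have -> : m%:Z - n%:Z = Negz (n - m).-1 by lia.
rewrite /= prednK ?subn_gt0 //.
by rewrite -{2}(subnK (ltnW nm)) exprD mulrCA GHn mulr1.
Qed.

Lemma zpowD i j : zpow (i + j) = zpow i * zpow j.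
Proof.
have split_int (k : int) : exists m n : nat, k = m%:Z - n%:Z.
  by case: k => n; [exists n, 0%N | exists 0%N, n.+1]; lia.
have [m [n ->]] := split_int i; have [p [q ->]] := split_int j.
have -> : m%:Z - n%:Z + (p%:Z - q%:Z) = (m + p)%N%:Z - (n + q)%N%:Z by lia.
by rewrite !zpowB !exprD; ring.
Qed.

Lemma deg_zpow k : deg_le k (lval (zpow k)).
Proof.
case: k => n /=; first by have := degX (n := n) degG; rewrite mul1r.
by have := degX (n := n.+1) degH; rewrite mulN1r NegzE.
Qed.

Lemma comp_window a m N n : deg_le N (lval a) -> N - n%:Z < m ->
  scomp near_infty (lval a) (lval G) m =
  \sum_(i < n) lval a (N - i%:Z) * lval (zpow (N - i%:Z)) m.
Proof.
move=> Na nm; rewrite /scomp (fsum_window (N := N) (n := n)) => [|i Hi].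
  by apply: eq_bigr => i _; rewrite spowz_zpow.
case: (ltrP N i) => Ni; first by rewrite Na ?mul0r.
by rewrite spowz_zpow deg_zpow ?mulr0 //; lia.
Qed.

Lemma deg_scomp a N : deg_le N (lval a) ->
  deg_le N (scomp near_infty (lval a) (lval G)).
Proof. by move=> Na k Nk; rewrite (comp_window (n := 0) Na) ?big_ord0 // subr0. Qed.

Fact comp_subproof a : `[< near_infty (scomp near_infty (lval a) (lval G)) >].
Proof. by apply/asboolP; have [N Na] := lvalP a; exists N; apply: deg_scomp. Qed.

Definition compose a : linf A := Linf (comp_subproof a).

Lemma lval_comp a m N n : deg_le N (lval a) -> N - n%:Z < m ->
  lval (compose a) m = \sum_(i < n) lval a (N - i%:Z) * lval (zpow (N - i%:Z)) m.
Proof. exact: comp_window. Qed.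

Lemma deg_comp a N : deg_le N (lval a) -> deg_le N (lval (compose a)).
Proof. exact: deg_scomp. Qed.

Lemma compD a b : compose (a + b) = compose a + compose b.
Proof.
apply: linfE => k; have [N [Na Nb]] := lvalP2 a b; have Nab := degD Na Nb.
have Nk : N - (absz (N - k)).+1%:Z < k by lia.
rewrite lvalD (lval_comp Nab Nk) (lval_comp Na Nk) (lval_comp Nb Nk).
by rewrite -big_split; apply: eq_bigr => i _; rewrite lvalD mulrDl.
Qed.

Lemma comp_mono c k : compose (mono c k) = mono c 0 * zpow k.
Proof.
apply: linfE => m; rewrite lval_monoM subr0 /= /scomp (fsum_delta (N := k)).
  by rewrite /smonom eqxx spowz_zpow.
by move=> i ik; rewrite /smonom (negPf ik) mul0r.
Qed.

Lemma comp1 : compose 1 = 1.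
Proof. by rewrite comp_mono mul1r. Qed.

(** On monomials this is [zpowD]; both sides are additive and continuous in
    [a] and in [b], so [additive_eq0] applies in each variable. *)
Lemma compM a b : compose (a * b) = compose a * compose b.
Proof.
apply: linfE => k; apply/eqP; rewrite -subr_eq0 -lvalB; apply/eqP.
move: a; apply: additive_eq0 => [a a' | c i | ].
- by rewrite mulrDl !compD mulrDl -lvalD; congr (lval _ k); ring.
- move: b; apply: additive_eq0 => [b b' | d j | ].
  + by rewrite mulrDr !compD mulrDr -lvalD; congr (lval _ k); ring.
  + have cd0 : mono (c * d) 0 = mono c 0 * mono d 0 by rewrite monoM addr0.
    by rewrite monoM !comp_mono zpowD cd0 mulrACA subrr.
  + have [N Nc] := lvalP (mono c i); exists (k - N - 1) => b kb.
    rewrite lvalB (deg_comp (degM Nc kb)) ?(degM (deg_comp Nc) (deg_comp kb)) ?subrr //;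
      lia.
- have [N Nb] := lvalP b; exists (k - N - 1) => a ka.
  rewrite lvalB (deg_comp (degM ka Nb)) ?(degM (deg_comp ka) (deg_comp Nb)) ?subrr //;
    lia.
Qed.

Lemma compN a : compose (- a) = - compose a.
Proof.
have -> : - a = mono (-1) 0 * a by rewrite monoN mulN1r.
by rewrite compM comp_mono mulr1 monoN mulN1r.
Qed.

Lemma euler_inv : euler H * G = - (H * euler G).
Proof.
have : euler (G * H) = 0 by rewrite GH euler1.
by rewrite eulerM => /eqP; rewrite addrC addr_eq0 mulrC => /eqP ->; rewrite mulrC.
Qed.

Lemma euler_zpow k : euler (zpow k) * G = k%:~R * zpow k * euler G.
Proof.
case: k => [[|n]|n]; first by rewrite euler1 !mul0r.
  by rewrite /zpow eulerX exprS -pmulrn; ring.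
rewrite /zpow eulerX -mulrA euler_inv NegzE mulrNz -pmulrn exprS; ring.
Qed.

(** The chain rule, multiplied by [G] to remain free of denominators. *)
Lemma comp_euler a : euler (compose a) * G = compose (euler a) * euler G.
Proof.
apply: linfE => k; apply/eqP; rewrite -subr_eq0 -lvalB; apply/eqP.
move: a; apply: additive_eq0 => [a a' | c i | ].
- by rewrite eulerD !compD eulerD -lvalD; congr (lval _ k); ring.
- rewrite euler_mono !comp_mono eulerM euler_const mul0r add0r -mulrA euler_zpow.
  have -> : mono (i%:~R * c) 0 = i%:~R * mono c 0.
    by rewrite -mono_intr monoM addr0.
  by rewrite [X in lval X](_ : _ = 0) //; ring.
- exists (k - 2) => a ka.
  have dG := deg_euler degG; have da := deg_comp (deg_euler ka : deg_le _ (lval (euler a))).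
  rewrite lvalB (degM (deg_euler (deg_comp ka) : deg_le _ (lval (euler _))) degG); last lia.
  by rewrite (degM da (dG : deg_le _ (lval (euler G)))) ?subrr //; lia.
Qed.

(** Invariance of the residue: that of a(G) dG/G equals that of a dz/z.  For
    a = z^k with k <> 0 the form is exact, since k G^(k-1) dG = d(G^k). *)
Lemma residue_comp a :
  (forall (k : int) (x : A), k != 0 -> k%:~R * x = 0 -> x = 0) ->
  lval (compose a * (euler G * H)) 0 = lval a 0.
Proof.
move=> char0; apply/eqP; rewrite -subr_eq0; apply/eqP.
have dG : deg_le 1 (lval (euler G)) := deg_euler degG.
move: a; apply: additive_eq0 => [a a' | c k | ].
- by rewrite compD mulrDl !lvalD; ring.
- rewrite comp_mono -mulrA lval_monoM subr0 lval_mono.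
  have [->|k0] := eqVneq k 0.
    have H1 : lval G 1 * lval H (-1) = 1.
      by rewrite -(lval_lead degG degH) GH.
    have := lval_lead dG degH; rewrite lval_euler mul1r H1 subrr => G0.
    by rewrite -[zpow 0]/(1 : linf A) mul1r G0 mulr1 subrr.
  rewrite subr0 [X in _ * X](char0 k _ k0) ?mulr0 //.
  have -> : k%:~R * lval (zpow k * (euler G * H)) 0 =
            lval (mono k%:~R 0 * (zpow k * (euler G * H))) 0.
    by rewrite lval_monoM subr0.
  by rewrite mono_intr !mulrA -euler_zpow -mulrA GH mulr1 lval_euler mul0r.
- exists (-1) => a a1.
  by rewrite (degM (deg_comp a1) (degM dG degH)) ?a1 ?subrr.
Qed.

End Composition.

(** * Reflection *)

Section Reflection.
Variable A : comNzRingType.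
Implicit Types a b : fseries A.

(** The substitution w |-> 1/w, which exchanges the expansions at 0 and oo. *)
Definition rf a : fseries A := fun k => a (- k).

Lemma rfK a : rf (rf a) = a.
Proof. by apply/funext => k; rewrite /rf opprK. Qed.

Lemma fsum_opp (F : int -> A) :
  \sum_(i \in [set: int]) F (- i) = \sum_(i \in [set: int]) F i.
Proof.
by rewrite [RHS](reindex_fsbigT (fun i : int => - i)).
Qed.

Lemma rfM a b : rf (a ** b) = rf a ** rf b.
Proof.
apply/funext => k; rewrite /rf /smul -fsum_opp; apply: eq_fsbigr => i _.
by congr (_ * b _); rewrite opprB opprK addrC.
Qed.

Lemma rf_monom (c : A) n : rf (smonom c n) = smonom c (- n).
Proof. by apply/funext => k; rewrite /rf /smonom eqr_oppLR. Qed.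

Lemma rf1 : rf sone = sone.
Proof. exact: rf_monom. Qed.

Lemma rfX a n : rf (spow a n) = spow (rf a) n.
Proof. by elim: n => [|n IH]; [exact: rf1 | rewrite /= rfM -IH]. Qed.

Lemma near_rf a : near_zero a <-> near_infty (rf a).
Proof.
by split=> -[N Na]; exists (- N) => k Hk; [|rewrite -[k]opprK]; apply: Na; lia.
Qed.

(** The reciprocal near 0 is computed by reflecting to infinity, where inverses
    are unique. *)
Lemma sinv_zero_rf a (G H : linf A) : rf a = lval G -> G * H = 1 ->
  sinv near_zero a = rf (lval H).
Proof.
move=> aG GH; apply: xget_unique => [|b [nb ab]].
  split; first by apply/near_rf; rewrite rfK; exact: lvalP.
  by rewrite -[LHS]rfK rfM rfK aG -lvalM GH rf1.
have bi : near_infty (rf b) by apply/near_rf.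
rewrite -[b]rfK; congr rf; rewrite -(sinv_unique GH).
rewrite (sinv_unique (b := Linf (asboolT bi))) //.
by apply: val_inj; rewrite /= -aG -rfM ab rf1.
Qed.

End Reflection.

Lemma rf_slog (K : fieldType) (A : comAlgType K) (a : fseries A) :
  rf (slog a) = slog (rf a).
Proof.
apply/funext => k; rewrite /rf /slog; apply: eq_fsbigr => i _.
congr (_ *: _); rewrite -[LHS]/(rf _ k) rfX.
by congr (spow _ i k); rewrite -[in RHS](rf1 A).
Qed.

(** * The logarithmic derivative *)

Section Log.
Variables (K : numFieldType) (A : comAlgType K).

(** The derivative of the logarithmic series is a geometric series in [- h],
    which multiplication by [a] = 1 + [h] telescopes. *)
Lemma slog_euler (a : linf A) : deg_le (-1) (lval (a - 1)) ->
  exists2 L : linf A, lval L = slog (lval a) & euler L * a = euler a.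
Proof.
set h := a - 1 => h1.
have hX n : deg_le (- n%:Z) (lval (h ^+ n)).
  by have := degX (n := n) h1; rewrite mulN1r.
pose c k : K := (-1) ^+ k.+1 / k%:R.
pose S n : linf A := \sum_(i < n) mono ((c i.+1)%:A) 0 * h ^+ i.+1.
have slogE n k : - n.+1%:Z < k -> slog (lval a) k = lval (S n) k.
  move=> nk; rewrite /slog lval_sum (fsbigE (iota 1 n)) ?iota_uniq //.
  - rewrite (eq_bigl (fun i => 0 < i)%N); last by move=> i; rewrite mem_setE.
    have -> : iota 1 n = index_iota 1 n.+1 by rewrite /index_iota subn1.
    rewrite big_add1 big_mkord; apply: eq_bigr => i _.
    by rewrite lval_monoM subr0 mulr_algl lvalX.
  - by move=> i /=; rewrite mem_iota => /andP[].
  - move=> i /= i0; rewrite mem_iota => Hi.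
    have -> : spow (lval a - sone) i = lval (h ^+ i) by rewrite lvalX.
    by rewrite hX ?scaler0 //; lia.
have L0 : deg_le 0 (slog (lval a)).
  by move=> k k0; rewrite (slogE 0%N) ?lval_sum ?big_ord0 //; lia.
exists (mk L0) => //; set L := mk L0.
have LS n : deg_le (- n%:Z) (lval (L - S n)).
  by move=> k nk; rewrite lvalB /= (slogE n) ?subrr //; lia.
have ES n : euler (S n) * (1 + h) = euler h * (1 - (- h) ^+ n).
  elim: n => [|n IH].
    by rewrite /S big_ord0 euler0 mul0r expr0 subrr mulr0.
  rewrite /S big_ord_recr eulerD mulrDl IH eulerM euler_const mul0r add0r eulerX.
  (* k times the k-th coefficient of log(1 + h) is a sign *)
  have cn : mono ((c n.+1)%:A) 0 * n.+1%:R = (-1) ^+ n :> linf A.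
    have sgn : mono ((-1) ^+ n) 0 = (-1) ^+ n :> linf A.
      by rewrite -[in LHS]signr_odd -[in RHS]signr_odd; case: (odd n); rewrite ?(expr1, expr0) ?monoN.
    rewrite -mono_natr monoM addr0 -sgn; congr mono.
    rewrite mulr_algl -scaler_nat scalerA /c !exprS mulN1r mulN1r opprK.
    by rewrite divfK ?pnatr_eq0 // -(rmorph_sign (in_alg A)).
  rewrite mulrA mulrA cn exprS [(- h) ^+ n]exprNn; ring.
apply: eq_approx => n.
have -> : euler L * a - euler a =
   euler (L - S n) * a - euler h * (- h) ^+ n.
  have -> : a = 1 + h by rewrite addrC subrK.
  rewrite eulerD eulerN eulerD euler1 mulrBl ES; ring.
have a0 : deg_le 0 (lval a).
  by rewrite -(subrK 1 a); apply: degD; [exact: deg_leW h1 | exact: deg1].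
have Eh : deg_le 0 (lval (euler h)) by apply: deg_euler; exact: deg_leW h1.
have hN : deg_le (- n%:Z) (lval ((- h) ^+ n)).
  by have := degX (n := n) (degN h1); rewrite mulN1r.
apply: degD.
  by have := degM (deg_euler (LS n) : deg_le _ (lval (euler (L - S n)))) a0; rewrite addr0.
by apply: degN; have := degM Eh hN; rewrite add0r.
Qed.

End Log.

(** * Faber polynomials *)

Section Lift.
Variable K : fieldType.
Implicit Types a b : linf K.

Lemma deg_lift N a : deg_le N (lval a) -> deg_le N (slift (lval a)).
Proof. by move=> Na k Nk; rewrite /slift Na. Qed.

Fact lift_subproof a : `[< near_infty (slift (lval a)) >].
Proof. by apply/asboolP; have [N Na] := lvalP a; exists N; apply: deg_lift. Qed.

Definition poly_lift a : linf {poly K} := Linf (lift_subproof a).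

Lemma lval_lift a k : lval (poly_lift a) k = (lval a k)%:P. Proof. by []. Qed.

Lemma lift_mono c n : poly_lift (mono c n) = mono c%:P n.
Proof. by apply: linfE => k; rewrite lval_lift !lval_mono; case: eqP. Qed.

Lemma liftM a b : poly_lift (a * b) = poly_lift a * poly_lift b.
Proof.
apply: linfE => k; rewrite lval_lift !lvalM.
have [N Na] := lvalP a; have [M Mb] := lvalP b.
have lNa := deg_lift Na; have lMb := deg_lift Mb.
have [[n ->]|H] := degP (N + M) k.
  rewrite !smul_degE // rmorph_sum; apply: eq_bigr => i _; exact: polyCM.
by rewrite (deg_leM Na Mb) ?(deg_leM lNa lMb).
Qed.

Lemma lift1 : poly_lift 1 = 1.
Proof. exact: lift_mono. Qed.

Lemma liftX a n : poly_lift (a ^+ n) = poly_lift a ^+ n.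
Proof. by elim: n => [|n IH]; rewrite ?lift1 // !exprS liftM IH. Qed.

Lemma lift_zpow (G H : linf K) k : poly_lift (zpow G H k) = zpow (poly_lift G) (poly_lift H) k.
Proof. by case: k => n; exact: liftX. Qed.

End Lift.

Section FaberCore.
Variable K : numFieldType.
Variables G H : linf K.
Hypotheses (GH : G * H = 1).
Hypotheses (degG : deg_le 1 (lval G)) (degH : deg_le (-1) (lval H)).

Lemma liftGH : poly_lift G * poly_lift H = 1.
Proof. by rewrite -liftM GH lift1. Qed.

Local Notation lG := (deg_lift degG : deg_le 1 (lval (poly_lift G))).
Local Notation lH := (deg_lift degH : deg_le (-1) (lval (poly_lift H))).
Local Notation lcomp := (compose liftGH lG lH).
Local Notation w := (mono 1 1 : linf {poly K}).
Local Notation winv := (mono 1 (-1) : linf {poly K}).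
Local Notation X0 := (mono 'X 0 : linf {poly K}).

Lemma lcomp_lift a : lcomp (poly_lift a) = poly_lift (compose GH degG degH a).
Proof.
apply: linfE => m; have [N Na] := lvalP a.
have lNa := deg_lift Na : deg_le N (lval (poly_lift a)).
have Nm : N - (absz (N - m)).+1%:Z < m by lia.
rewrite lval_lift (lval_comp liftGH lG lH lNa Nm) (lval_comp GH degG degH Na Nm).
rewrite rmorph_sum; apply: eq_bigr => i _.
by rewrite -lift_zpow !lval_lift; exact/esym/polyCM.
Qed.

Lemma wwinv : w * winv = 1.
Proof. by rewrite monoM mulr1 subrr. Qed.

Lemma lcomp_const (c : {poly K}) : lcomp (mono c 0) = mono c 0.
Proof. by rewrite comp_mono mulr1. Qed.

Lemma poly_char0 (k : int) (x : {poly K}) : k != 0 -> k%:~R * x = 0 -> x = 0.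
Proof.
move=> k0 /eqP; rewrite mulf_eq0 => /orP[|/eqP //].
rewrite -(rmorph_int (@polyC K)) polyC_eq0 intr_eq0 => /eqP k1.
by rewrite k1 eqxx in k0.
Qed.

(** For T = sum_n T_n z^-n, the hypothesis says that T(G) dG/G equals
    dw/w sum_m 'X^m w^-m.  By invariance of the residue, T_n is the residue of
    G^n T(G) dG/G, that is of G^n sum_m 'X^m w^-m dw/w, which reads off the
    coefficients of nonnegative powers of w in G^n. *)
Lemma faber_core (T : linf {poly K}) :
  (1 - X0 * winv) * (lcomp T * (euler (poly_lift G) * poly_lift H)) = 1 ->
  forall n : nat, lval T (- n%:Z) = \poly_(m < n.+1) lval (G ^+ n) m%:Z.
Proof.
move=> HT n.
pose ge : fseries {poly K} := fun k => if k <= 0 then 'X^(absz k) else 0.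
have ge0 : deg_le 0 ge by move=> k k0; rewrite /ge ifF //; lia.
(* ge is the expansion of w / (w - 'X) *)
have geE : (1 - X0 * winv) * mk ge0 = 1.
  apply: linfE => k; rewrite mulrBl mul1r monoM mulr1 add0r lvalB lval_monoM.
  rewrite lval1 /sone /smonom /= /ge opprK.
  have [->|k0] := eqVneq k 0; first by rewrite lexx /= mulr0 expr0 subr0.
  case: (lerP k 0) => kl; last by rewrite ifF ?mulr0 ?subrr //; lia.
  rewrite ifT; last lia.
  have kS : absz k = (absz (k + 1)).+1 by lia.
  by rewrite kS exprS subrr.
have CT : lcomp T * (euler (poly_lift G) * poly_lift H) = mk ge0.
  by rewrite -[LHS]mul1r -{1}geE mulrAC HT mul1r.
have := residue_comp liftGH lG lH (mono 1 n * T) poly_char0.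
rewrite lval_monoM mul1r add0r => <-.
rewrite compM comp_mono mul1r -mulrA CT /zpow -liftX lvalM.
have Gn : deg_le n (lval (poly_lift (G ^+ n))).
  by apply: deg_lift; have := degX (n := n) degG; rewrite mul1r.
have := smul_degE n Gn ge0; rewrite addr0 subrr => ->.
rewrite (reindex_inj rev_ord_inj) poly_def; apply: eq_bigr => i _ /=.
have -> : (n%:Z - (n.+1 - i.+1)%N%:Z) = i%:Z by have := ltn_ord i; lia.
have -> : (n - (n.+1 - i.+1))%N = i by have := ltn_ord i; lia.
rewrite /ge ifT; last lia.
by rewrite /slift mul_polyC; congr (_ *: 'X^ _); lia.
Qed.

End FaberCore.

Section FaberInfty.
Variable K : numFieldType.
Variables G H : linf K.
Hypotheses (GH : G * H = 1).
Hypotheses (degG : deg_le 1 (lval G)) (degH : deg_le (-1) (lval H)).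
Variables (r : K).
Hypothesis r0 : r != 0.

Lemma euler_log_coefs (L : linf {poly K}) (p : nat -> {poly K}) :
  lval L = log_coefs_infty p ->
  forall n : nat, (0 < n)%N -> lval (1 - euler L) (- n%:Z) = p n.
Proof.
move=> LE n n0; rewrite lvalB lval_euler LE lval1 /sone /smonom /log_coefs_infty.
rewrite ifF; last lia. rewrite ifT; last lia.
rewrite sub0r mulrNz mulNr opprK abszN absz_nat.
by rewrite mulr_natl -scaler_nat scalerA mulfV ?scale1r // pnatr_eq0; lia.
Qed.

(** Differentiating the logarithm that defines Phi gives
    T (g - 'X) = z g' with T = 1 + sum_n Phi_n z^-n; substituting z = G(w),
    where g(G) = w, turns this into the hypothesis of [faber_core]. *)
Lemma faber_inftyE (g : linf K) (Phi : nat -> {poly K}) :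
  deg_le 1 (lval g) -> lval g 1 = r^-1 ->
  scomp near_infty (lval g) (lval G) = smonom 1 1 ->
  faber_infty r (lval g) Phi ->
  forall n : nat, (0 < n)%N -> Phi n = \poly_(m < n.+1) lval (G ^+ n) m%:Z.
Proof.
move=> g1 gr gG HPhi n n0.
pose rw : linf {poly K} := mono r%:P (-1).
pose a := rw * (poly_lift g - mono 'X 0).
have a1 : deg_le (-1) (lval (a - 1)).
  move=> k k1; rewrite lvalB lval_monoM opprK lvalB lval_lift lval_mono lval1 /sone /smonom.
  have [->|k0] := eqVneq k 0.
    by rewrite add0r gr /= subr0 -polyCM mulfV // subrr.
  by rewrite g1 ?ifF ?subr0 ?mulr0 //; lia.
have [L LE La] := slog_euler a1.
have LPhi : lval (- L) = log_coefs_infty Phi.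
  by apply: oppr_inj; rewrite -HPhi -[slog _]/(slog (lval a)) -LE; apply/funext => k; exact: opprK.
rewrite -(euler_log_coefs LPhi n0) eulerN opprK.
apply: (@faber_core _ _ _ GH degG degH).
set T := 1 + euler L.
have rwK : mono r^-1%:P 1 * rw = 1.
  by rewrite monoM -polyCM mulVf // subrr.
have Tg : T * (poly_lift g - mono 'X 0) = euler (poly_lift g).
  have Ea : euler a = - a + rw * euler (poly_lift g).
    rewrite eulerM euler_mono eulerD eulerN euler_const subr0.
    by rewrite mulN1r monoN mulNr.
  have : rw * (T * (poly_lift g - mono 'X 0)) = rw * euler (poly_lift g).
    transitivity (T * a); first by rewrite /a; ring.
    by rewrite mulrDl mul1r La Ea; ring.
  by move/(congr1 ( *%R (mono r^-1%:P 1))); rewrite !mulrA rwK !mul1r.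
have cg : compose GH degG degH g = mono 1 1 by apply: val_inj.
set C := compose _ _ _.
have C1 : C T * (mono 1 1 - mono 'X 0) = C (euler (poly_lift g)).
  by rewrite -Tg /C compM compD -monoN lcomp_const lcomp_lift cg lift_mono.
have C2 : C (euler (poly_lift g)) * euler (poly_lift G) = mono 1 1 * poly_lift G.
  by rewrite /C -comp_euler lcomp_lift cg lift_mono euler_mono mul1r.
transitivity (mono 1 (-1) * (C T * (mono 1 1 - mono 'X 0) * euler (poly_lift G)) * poly_lift H).
  rewrite !mulrA mulrBr; rewrite -{1}(wwinv K); ring.
by rewrite C1 C2 mulrA [mono 1 (-1) * _]mulrC wwinv mul1r liftGH.
Qed.

(** Here [f] is the reflection of the inverse function f0 near 0, and [G] that
    of the reciprocal of the function which f0 inverts.  Differentiating both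
    logarithms gives T (1 - 'X f) f = - z f' with T = 1 + sum_n Psi_n z^-n, and
    f(G) = 1/w leads to the same hypothesis of [faber_core]. *)
Lemma faber_zeroE (f : linf K) (Psi : nat -> {poly K}) :
  deg_le (-1) (lval f) -> lval f (-1) = r ->
  scomp near_infty (lval f) (lval G) = smonom 1 (-1) ->
  faber_zero r (rf (lval f)) Psi ->
  forall n : nat, (0 < n)%N -> Psi n = \poly_(m < n.+1) lval (G ^+ n) m%:Z.
Proof.
move=> f1 fr fG HPsi n n0.
have lf1 : deg_le (-1) (lval (poly_lift f)) := deg_lift f1.
pose X0 : linf {poly K} := mono 'X 0.
pose rw : linf {poly K} := mono (r^-1)%:P 1.
pose a := 1 - X0 * poly_lift f; pose b := rw * poly_lift f.
have a1 : deg_le (-1) (lval (a - 1)).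
  rewrite /a addrC addKr; apply: degN; rewrite -[-1]add0r.
  apply: degM lf1; exact: deg_le_monom.
have b1 : deg_le (-1) (lval (b - 1)).
  move=> k k1; rewrite lvalB lval_monoM lval_lift lval1 /sone /smonom.
  have [->|k0] := eqVneq k 0; first by rewrite sub0r fr -polyCM mulVf // subrr.
  by rewrite f1 ?mulr0 ?subrr //; lia.
have [La LaE Ea] := slog_euler a1; have [Lb LbE Eb] := slog_euler b1.
have LPsi : lval (Lb - La) = log_coefs_infty Psi.
  have := congr1 (@rf _) HPsi; rewrite rf_slog.
  have -> : rf (sone - smonom 'X 0 ** slift (rf (lval f))) = lval a.
    transitivity (rf sone - rf (smonom 'X 0 ** slift (rf (lval f)))) => //.
    rewrite rf1 rfM rf_monom oppr0; congr (_ - _ ** _).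
    by apply/funext => k; rewrite /rf /slift opprK.
  rewrite -LaE => E.
  have {}E : lval La = lval Lb - log_coefs_infty Psi.
    rewrite E; transitivity (rf (slog (smonom r^-1%:P (-1) ** slift (rf (lval f))))
        - rf (log_coefs_zero Psi)) => //.
    congr (_ - _).
      rewrite rf_slog rfM rf_monom opprK LbE; congr (slog (_ ** _)).
      by apply/funext => k; rewrite /rf /slift opprK.
    by apply/funext => k; rewrite /rf /log_coefs_zero /log_coefs_infty oppr_gt0 abszN.
  apply/funext => k; rewrite lvalB E -[(_ - log_coefs_infty _) k]/(_ k - _ k).
  by rewrite opprB addrC subrK.
rewrite -(euler_log_coefs LPsi n0).
apply: (@faber_core _ _ _ GH degG degH).
set T := 1 - euler _.
have rwK : mono r%:P (-1) * rw = 1.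
  by rewrite monoM -polyCM mulfV // addNr.
have Tf : T * ((1 - X0 * poly_lift f) * poly_lift f) = - euler (poly_lift f).
  have Ea' : euler a = - (X0 * euler (poly_lift f)).
    by rewrite eulerD euler1 eulerN eulerM euler_const mul0r !add0r.
  have Eb' : euler b = b + rw * euler (poly_lift f) by rewrite eulerM euler_mono mul1r.
  have : rw * (T * ((1 - X0 * poly_lift f) * poly_lift f)) = rw * - euler (poly_lift f).
    transitivity (T * a * b); first by rewrite /a /b; ring.
    transitivity (a * b - euler Lb * b * a + euler La * a * b).
      by rewrite /T eulerD eulerN; ring.
    by rewrite Ea Eb Ea' Eb' /a /b; ring.
  by move/(congr1 ( *%R (mono r%:P (-1)))); rewrite !mulrA rwK !mul1r.
have cf : compose GH degG degH f = mono 1 (-1) by apply: val_inj.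
set C := compose _ _ _.
have Cf : C (poly_lift f) = mono 1 (-1) by rewrite /C lcomp_lift cf lift_mono.
have C1 : C T * ((1 - X0 * mono 1 (-1)) * mono 1 (-1)) = - C (euler (poly_lift f)).
  clearbody T; have -> : - C (euler (poly_lift f)) = C (T * ((1 - X0 * poly_lift f) * poly_lift f)).
    by rewrite Tf -compN.
  by rewrite /C !compM compD compN compM comp1 lcomp_const -/C Cf.
have C2 : C (euler (poly_lift f)) * euler (poly_lift G) = - (mono 1 (-1) * poly_lift G).
  by rewrite /C -comp_euler -/C Cf euler_mono mulrN1z mulN1r monoN mulNr.
transitivity (mono 1 1 * (C T * ((1 - X0 * mono 1 (-1)) * mono 1 (-1)) * euler (poly_lift G)) * poly_lift H).
  by rewrite -[LHS]mul1r -[X in X * _ = _](wwinv K) /X0; ring.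
by rewrite C1 mulNr C2 opprK mulrA wwinv mul1r liftGH.
Qed.

End FaberInfty.

(** * The Loewner relation *)

Section LoewnerRelation.
Variable K : numFieldType.
Implicit Types (a b q d M : fseries K) (p s x : K).

(** In closed form, (1 - s/w) d = p (1 + s/w) (w q' - x), where
    (1 + s/w)/(1 - s/w) is minus the kernel (s + w)/(s - w).  Clearing the
    denominator makes the relation independent of the point of expansion and
    stable under w |-> 1/w. *)
Definition loewner_rel p s x q d : Prop :=
  forall k : int,
    d k - s * d (k + 1) =
    p * (k%:~R * q k - (if k == 0 then x else 0)
         + s * ((k + 1)%:~R * q (k + 1) - (if k + 1 == 0 then x else 0))).

(** Under w |-> 1/w the derivation w d/dw changes sign and (1 + s w)/(1 - s w)
    becomes - (1 + s'/w)/(1 - s'/w) with s' = 1/s; the two signs cancel in front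
    of w q', and x changes sign. *)
Lemma loewner_rel_rf p s s' x q d : s * s' = 1 ->
  loewner_rel p s x q d -> loewner_rel p s' (- x) (rf q) (rf d).
Proof.
move=> ss' H k; have := H (- k - 1); rewrite /rf opprD subrK.
have -> : (- k - 1 == 0) = (k + 1 == 0) by lia.
have -> : (- k == 0) = (k == 0) by lia.
move=> /(congr1 ( *%R (- s'))).
have -> : forall u v : K, - s' * (u - s * v) = v - s' * u.
  by move=> u v; rewrite -[v in RHS]mul1r -ss'; ring.
move=> ->; rewrite !intrD !intrN.
move: (q (- k)) (q (- k - 1)) => u v.
have -> : forall u v : K, - s' * (p * (u + s * v)) = - p * (s' * u + v).
  by move=> y z; rewrite -[z in RHS]mul1r -ss'; ring.
by case: (k == 0); case: (k + 1 == 0); ring.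
Qed.

Lemma loewner_relP p s x (q d : linf K) :
  loewner_rel p s x (lval q) (lval d) <->
  d * (1 - mono s (-1)) =
  mono p 0 * ((1 + mono s (-1)) * (euler q - mono x 0)).
Proof.
have L k : lval (d * (1 - mono s (-1))) k = lval d k - s * lval d (k + 1).
  by rewrite mulrC mulrBl mul1r lvalB lval_monoM opprK.
have Rk k : lval (mono p 0 * ((1 + mono s (-1)) * (euler q - mono x 0))) k =
   p * (k%:~R * lval q k - (if k == 0 then x else 0)
     + s * ((k + 1)%:~R * lval q (k + 1) - (if k + 1 == 0 then x else 0))).
  by rewrite lval_monoM subr0 mulrDl mul1r lvalD lval_monoM opprK !lvalB.
split => [H|E k]; first by apply: linfE => k; rewrite L Rk.
by rewrite -L -Rk E.
Qed.

(** After multiplication by (1 - s/w), both products on the left contain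
    p (1 + s/w) (w q') (w M'); these terms cancel and only x is left.  The factor
    (1 - s/w) is invertible at infinity and can be dropped. *)
Lemma loewner_bracket_infty p s x q d M M' :
  near_infty q -> near_infty d -> near_infty M -> near_infty M' ->
  loewner_rel p s x q d -> loewner_rel p s 0 M M' ->
  seuler q ** M' - d ** seuler M = (fun k => x * M' k).
Proof.
move=> nq nd nM nM' Hd HM.
pose lq := Linf (asboolT nq); pose ld := Linf (asboolT nd).
pose lM := Linf (asboolT nM); pose lM' := Linf (asboolT nM').
have s1 : deg_le (-1) (lval (mono s (-1))) by exact: deg_le_monom.
have [y [yK _]] := one_sub_inv s1.
have /(loewner_relP p s x lq ld) Ed := Hd.
have /(loewner_relP p s 0 lM lM') EM := HM.
rewrite mono0 subr0 in EM.
have key : euler lq * lM' - ld * euler lM = mono x 0 * lM'.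
  suff E : (1 - mono s (-1)) * (euler lq * lM' - ld * euler lM) =
           (1 - mono s (-1)) * (mono x 0 * lM').
    by rewrite -[LHS]mul1r -[RHS]mul1r -yK -!mulrA E.
  transitivity (euler lq * (lM' * (1 - mono s (-1)))
                - ld * (1 - mono s (-1)) * euler lM); first by ring.
  transitivity (mono x 0 * (lM' * (1 - mono s (-1)))); last by ring.
  by rewrite Ed EM; ring.
transitivity (lval (euler lq * lM' - ld * euler lM)) => //.
by rewrite key; apply/funext => k; rewrite lval_monoM subr0.
Qed.

Lemma rf_seuler a : rf (seuler a) = - seuler (rf a).
Proof.
apply/funext => k; rewrite -[RHS]/(- (k%:~R * a (- k))) /rf /seuler.
by rewrite intrN mulNr.
Qed.

Lemma smulNl a b : (- a) ** b = - (a ** b).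
Proof.
apply/funext => k; rewrite -[RHS]/(- (a ** b) k) /smul -[RHS]mulN1r mulr_fsumr.
by apply: eq_fsbigr => i _; rewrite mulN1r -mulNr.
Qed.

Lemma smulNr a b : a ** (- b) = - (a ** b).
Proof.
apply/funext => k; rewrite -[RHS]/(- (a ** b) k) /smul -[RHS]mulN1r mulr_fsumr.
by apply: eq_fsbigr => i _; rewrite mulN1r -mulrN.
Qed.

Lemma loewner_bracket_zero p s x q d M M' : s != 0 ->
  near_zero q -> near_zero d -> near_zero M -> near_zero M' ->
  loewner_rel p s x q d -> loewner_rel p s 0 M M' ->
  seuler q ** M' - d ** seuler M = (fun k => x * M' k).
Proof.
move=> s0 /near_rf nq /near_rf nd /near_rf nM /near_rf nM' Hd HM.
have ss : s * s^-1 = 1 by rewrite mulfV.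
have Hd' := loewner_rel_rf ss Hd; have HM' := loewner_rel_rf ss HM.
rewrite oppr0 in HM'.
have E := loewner_bracket_infty nq nd nM nM' Hd' HM'.
rewrite -[LHS]rfK -[RHS]rfK; congr rf.
transitivity (rf (seuler q ** M') - rf (d ** seuler M)) => //.
rewrite !rfM !rf_seuler smulNl smulNr.
transitivity (- (seuler (rf q) ** rf M' - rf d ** seuler (rf M))).
  by rewrite opprB addrC opprK addrC.
by rewrite E; apply/funext => k; rewrite -[LHS]/(- (- x * rf M' k)) mulNr opprK.
Qed.

(** The operator that sends L^n to the Hamiltonian B_n of the hierarchy. *)
Definition upper_part a : fseries K :=
  strunc (fun k => 0 < k) a + 2^-1 *: strunc (fun k => k == 0) a.

Lemma upper_partE a k :
  upper_part a k = if 0 < k then a k else if k == 0 then 2^-1 * a k else 0.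
Proof.
rewrite -[LHS]/(strunc _ a k + 2^-1 * strunc _ a k) /strunc.
by case: (ltrgtP 0 k) => _; rewrite ?mulr0 ?addr0 ?add0r.
Qed.

(** Discarding negative powers disturbs the two-term recursion only at k = 0 and
    k = -1, and the weight 1/2 of the constant term makes the defect at both
    places the same constant: telescoping the recursion for [d] upwards from
    k = 0 gives d_0 = 2 p x. *)
Lemma loewner_upper p s a d (n : nat) :
  deg_le n a -> deg_le n d -> loewner_rel p s 0 a d ->
  loewner_rel p s (\sum_(m < n.+1) m%:R * a m%:Z * s ^+ m)
    (upper_part a) (upper_part d).
Proof.
move=> na nd H; set x := \sum_(m < _) _.
have d0 : d 0 = 2 * p * x.
  have tele N : d 0 = s ^+ N * d N%:Z - p * s ^+ N * (N%:R * a N%:Z)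
      + 2 * p * \sum_(m < N.+1) m%:R * a m%:Z * s ^+ m.
    elim: N => [|N IH].
      by rewrite big_ord_recl big_ord0 !mul0r !expr0 !mul1r !mulr0 subr0 !addr0 mulr0 addr0.
    have eN : N.+1%:Z = N%:Z + 1 by lia.
    have := H N%:Z; rewrite !if_same !subr0 intrD -pmulrn => HN.
    have {}HN : d N%:Z = s * d (N%:Z + 1)
        + p * (N%:R * a N%:Z + s * ((N%:R + 1) * a (N%:Z + 1))).
      by rewrite -HN; ring.
    by rewrite big_ord_recr /= IH HN eN exprS -[N.+1%:R]natr1; ring.
  have dn : d n.+1%:Z = 0 by apply: nd; lia.
  have an : a n.+1%:Z = 0 by apply: na; lia.
  rewrite (tele n.+1) dn an !mulr0 subr0 add0r big_ord_recr /= an.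
  by rewrite mulr0 mul0r addr0.
move=> k; have := H k; rewrite !upper_partE !if_same !subr0.
have two0 : 2 != 0 :> K by rewrite pnatr_eq0.
case: (ltrgtP 0 k) => k0.
- have -> : 0 < k + 1 by lia.
  have -> : (k + 1 == 0) = false by lia.
  by rewrite !subr0.
- have [k1|k1] := eqVneq (k + 1) 0.
    by rewrite k1 ltxx d0 => _; field.
  have -> : (0 < k + 1) = false by lia.
  by rewrite !(mulr0, subr0, addr0).
- rewrite -k0 /= !add0r !mul0r d0 => E; rewrite subr0.
  have -> : s * d 1 = 2 * p * x - p * (0 + s * (1%:~R * a 1)).
    by rewrite -E; ring.
  by field.
Qed.

End LoewnerRelation.

(** * Solutions of the Loewner equation *)

Section LoewnerSolutions.
Variable K : numFieldType.
Implicit Types (p s : K) (G H : linf K).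

Lemma loewner_pow p s G G' n :
  loewner_rel p s 0 (lval G) (lval G') ->
  loewner_rel p s 0 (lval (G ^+ n.+1)) (lval (n.+1%:R * G ^+ n * G')).
Proof.
move=> /loewner_relP; rewrite mono0 subr0 => E.
by apply/loewner_relP; rewrite mono0 subr0 -mulrA E eulerX; ring.
Qed.

(** Both derivatives of the inverse of [G] are those of [G] times - H^2. *)
Lemma loewner_inv p s G H G' H' : G * H = 1 -> G' * H + G * H' = 0 ->
  loewner_rel p s 0 (lval G) (lval G') -> loewner_rel p s 0 (lval H) (lval H').
Proof.
move=> GH GH' /loewner_relP; rewrite mono0 subr0 => E.
apply/loewner_relP; rewrite mono0 subr0.
have deriv_inv (x y : linf K) : x * H + G * y = 0 -> y = - (H * H * x).
  move=> xy; have Gy : G * y = - (x * H) by apply/eqP; rewrite -addr_eq0 addrC xy.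
  transitivity (H * (G * y)); first by rewrite mulrA [H * G]mulrC GH mul1r.
  by rewrite Gy; ring.
have EH : euler H = - (H * H * euler G).
  by apply: deriv_inv; rewrite -eulerM GH euler1.
rewrite EH (deriv_inv _ _ GH').
transitivity (- (H * H * (G' * (1 - mono s (-1))))); first by ring.
by rewrite E; ring.
Qed.

Lemma loewner_kernel_rel p s (G : linf K) :
  loewner_rel p s 0 (lval G)
    (- (p *: (seuler (lval G) **
       ((smonom s 0 + smonom 1 1) ** sinv near_infty (smonom s 0 - smonom 1 1))))).
Proof.
pose A : linf K := mono s 0 - mono 1 1.
have A1 : deg_le 1 (lval A).
  apply: degD; last exact/degN/deg_le_monom.
  by apply: (@deg_leW _ 0) => //; exact: deg_le_monom.
have lA : -1 * lval A 1 = 1 by rewrite lvalB !lval_mono sub0r mulN1r opprK.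
have [B [AB _]] := inv_exists A1 lA.
have -> : sinv near_infty (smonom s 0 - smonom 1 1) = lval B.
  by rewrite -(sinv_unique AB).
set d : fseries K := - _.
have -> : d = lval (- (mono p 0 * (euler G * ((mono s 0 + mono 1 1) * B)))).
  apply/funext => k; rewrite lvalN lval_monoM subr0 //.
apply/loewner_relP; rewrite mono0 subr0.
have ww : mono 1 1 * mono 1 (-1) = 1 :> linf K by rewrite monoM mulr1 subrr.
have -> : mono s (-1) = mono s 0 * mono 1 (-1) :> linf K by rewrite monoM mulr1 add0r.
have -> : 1 - mono s 0 * mono 1 (-1) = - (mono 1 (-1) * A) :> linf K.
  by rewrite -ww /A; ring.
transitivity (mono p 0 * (euler G * ((mono s 0 + mono 1 1) * mono 1 (-1))) * (A * B)).
  by ring.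
by rewrite AB mulr1 -ww; ring.
Qed.

(** Reflection turns f(F(w)) near 0 into a composition at infinity with the
    reciprocal of the reflection of F, in which the coefficients of f are read
    backwards. *)
Lemma scomp_zero_rf (f F : fseries K) G H :
  (forall k : int, k < 0 -> f k = 0) -> rf F = lval H -> G * H = 1 ->
  scomp near_infty (rf f) (lval G) = rf (scomp near_zero f F).
Proof.
move=> f0 FH GH; apply/funext => m; rewrite /rf /scomp -fsum_opp.
apply: eq_fsbigr => k _; rewrite opprK (spowz_zpow GH).
case: k => n; last by rewrite f0 ?mul0r.
congr (_ * _); rewrite /= -[RHS]/(rf (spow F n) m) rfX FH -lvalX.
by case: n => // n; rewrite -NegzE.
Qed.

End LoewnerSolutions.

(** * The velocities *)

Section Velocities.
Variable K : numFieldType.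
Implicit Types (s : K) (c : nat -> K).

Lemma xi_pos s c (Phi Psi : nat -> {poly K}) (n : nat) : (0 < n)%N ->
  Phi n = \poly_(m < n.+1) c m ->
  xi s Phi Psi n%:Z = \sum_(m < n.+1) m%:R * c m * s ^+ m.
Proof.
case: n => // n _ PhiE; rewrite /xi PhiE /seval.
rewrite -fsum_opp (fsum_window (N := 0) (n := n.+1)) => [|i Hi].
  rewrite [in RHS]big_ord_recl /= !mul0r add0r mulr_sumr; apply: eq_bigr => i _.
  rewrite sub0r opprK /sderiv.
  have -> : i%:Z + 1 = i.+1%:Z by lia.
  rewrite -[poly_w _ _]/((\poly_(m < n.+2) c m)`_i.+1).
  rewrite coef_poly ltnS ltn_ord /bump leq0n add1n -pmulrn exprS -exprnP; ring.
rewrite /sderiv /poly_w; case: ifP => // k0; last by rewrite mulr0 mul0r.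
have [i1|i1] := eqVneq i 1; first by rewrite i1 mul0r mul0r.
by rewrite coef_poly ifF ?mulr0 ?mul0r //; lia.
Qed.

Lemma xi_neg s c (Phi Psi : nat -> {poly K}) (n : nat) : (0 < n)%N -> s != 0 ->
  Psi n = \poly_(m < n.+1) c m ->
  xi s Phi Psi (- n%:Z) = - \sum_(m < n.+1) m%:R * c m * s^-1 ^+ m.
Proof.
case: n => // n _ s0 PsiE; rewrite -NegzE /xi PsiE /seval.
rewrite (fsum_window (N := -2) (n := n.+1)) => [|i Hi].
  rewrite [in RHS]big_ord_recl /= !mul0r add0r mulr_sumr -sumrN; apply: eq_bigr => i _.
  have -> : -2 - i%:Z = Negz i.+1 by lia.
  rewrite /sderiv; have -> : Negz i.+1 + 1 = Negz i by lia.
  rewrite -[poly_winv _ _]/((\poly_(m < n.+2) c m)`_i.+1) -[s ^ _]/(s ^- i.+2) NegzE.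
  rewrite coef_poly ltnS ltn_ord /bump leq0n add1n.
  rewrite intrN -pmulrn exprSr invfM -exprVn; field.
  by rewrite s0.
rewrite /sderiv /poly_winv; case: ifP => // k0; last by rewrite mulr0 mul0r.
have [i1|i1] := eqVneq i (-1); first by rewrite i1 mul0r mul0r.
by rewrite coef_poly ifF ?mulr0 ?mul0r //; lia.
Qed.

End Velocities.

(** * Derivatives of series with complex coefficients *)

Section Derivatives.
Variable R : realType.
Local Notation C := R[i].
Implicit Types (h : R -> C) (x : R).

Definition is_cderive h x (d : C) :=
  is_derive x 1 (fun s => complex.Re (h s)) (complex.Re d) /\
  is_derive x 1 (fun s => complex.Im (h s)) (complex.Im d).

Lemma cderivableP h x : cderivable h x -> is_cderive h x (cderive h x).
Proof.
by case=> hr hi; split; rewrite /= derive1E; apply: derivableP.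
Qed.

Lemma is_cderiveP h x d : is_cderive h x d -> cderivable h x /\ cderive h x = d.
Proof.
case=> hr hi; split; first by split; apply: ex_derive.
by rewrite /cderive !derive1E !derive_val; case: d hr hi.
Qed.

Lemma is_cderive_uniq h x d e : is_cderive h x d -> is_cderive h x e -> d = e.
Proof. by move=> /is_cderiveP[_ <-] /is_cderiveP[_ <-]. Qed.

Lemma is_cderive_cst c x : is_cderive (fun=> c) x 0.
Proof. by split; exact: is_derive_cst. Qed.

Lemma is_cderive_real (f : R -> R) x d :
  is_derive x 1 f d -> is_cderive (fun s => (f s)%:C) x d%:C.
Proof. by split => //; exact: is_derive_cst. Qed.

Lemma is_cderive_conj h x d :
  is_cderive h x d -> is_cderive (fun s => (h s)^*) x d^*.
Proof.
case=> hr hi; split.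
  have -> : complex.Re d^* = complex.Re d by case: (d).
  have -> // : (fun s => complex.Re (h s)^*) = (fun s => complex.Re (h s)).
  by apply/funext => s; case: (h s).
have -> : complex.Im d^* = - complex.Im d by case: (d).
have -> : (fun s => complex.Im (h s)^*) = - (fun s => complex.Im (h s)).
  by apply/funext => s; rewrite fctE; case: (h s).
exact: is_deriveN.
Qed.

Lemma ReD (y z : C) : complex.Re (y + z) = complex.Re y + complex.Re z.
Proof. by case: y; case: z. Qed.
Lemma ImD (y z : C) : complex.Im (y + z) = complex.Im y + complex.Im z.
Proof. by case: y; case: z. Qed.
Lemma ReM (y z : C) : complex.Re (y * z) =
  complex.Re y * complex.Re z - complex.Im y * complex.Im z.
Proof. by case: y; case: z. Qed.
Lemma ImM (y z : C) : complex.Im (y * z) =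
  complex.Re y * complex.Im z + complex.Im y * complex.Re z.
Proof. by case: y => a b; case: z => c d /=; rewrite [b * c]mulrC [c * b]mulrC. Qed.

Lemma is_cderiveD h (k : R -> C) x d e : is_cderive h x d -> is_cderive k x e ->
  is_cderive (fun s => h s + k s) x (d + e).
Proof.
case=> hr hi [kr ki]; split; rewrite ?ReD ?ImD.
  have -> : (fun s => complex.Re (h s + k s)) =
      (fun s => complex.Re (h s)) + (fun s => complex.Re (k s)).
    by apply/funext => s; rewrite ReD.
  exact: is_deriveD.
have -> : (fun s => complex.Im (h s + k s)) =
    (fun s => complex.Im (h s)) + (fun s => complex.Im (k s)).
  by apply/funext => s; rewrite ImD.
exact: is_deriveD.
Qed.

Lemma is_cderiveM h (k : R -> C) x d e : is_cderive h x d -> is_cderive k x e ->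
  is_cderive (fun s => h s * k s) x (d * k x + h x * e).
Proof.
case=> hr hi [kr ki]; split.
  have -> : (fun s => complex.Re (h s * k s)) =
      (fun s => complex.Re (h s)) * (fun s => complex.Re (k s))
      - (fun s => complex.Im (h s)) * (fun s => complex.Im (k s)).
    by apply/funext => s; rewrite ReM.
  apply: is_derive_eq.
  rewrite ReD !ReM; rewrite /GRing.scale /=; ring.
have -> : (fun s => complex.Im (h s * k s)) =
    (fun s => complex.Re (h s)) * (fun s => complex.Im (k s))
    + (fun s => complex.Im (h s)) * (fun s => complex.Re (k s)).
  by apply/funext => s; rewrite ImM.
apply: is_derive_eq.
rewrite ImD !ImM; rewrite /GRing.scale /=; ring.
Qed.

Lemma is_cderive_sum n (h : 'I_n -> R -> C) x (d : 'I_n -> C) :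
  (forall i, is_cderive (h i) x (d i)) ->
  is_cderive (fun s => \sum_(i < n) h i s) x (\sum_(i < n) d i).
Proof.
elim: n h d => [|n IH] h d hd.
  have -> : (fun s => \sum_(i < 0) h i s) = (fun=> 0).
    by apply/funext => s; rewrite big_ord0.
  by rewrite big_ord0; exact: is_cderive_cst.
have -> : (fun s => \sum_(i < n.+1) h i s) =
    (fun s => h ord0 s + \sum_(i < n) h (lift ord0 i) s).
  by apply/funext => s; rewrite big_ord_recl.
by rewrite big_ord_recl; apply: is_cderiveD => //; apply: IH => i.
Qed.

Lemma is_cderive_comp h (f : R -> R) x d e :
  is_cderive h (f x) d -> is_derive x 1 f e ->
  is_cderive (h \o f) x (e%:C * d).
Proof.
case=> hr hi fe; split.
  rewrite ReM /= mul0r subr0 mulrC; exact: (realfun.is_derive1_comp hr fe).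
rewrite ImM /= mul0r addr0 mulrC; exact: (realfun.is_derive1_comp hi fe).
Qed.

Definition is_sderive (a : R -> fseries C) x (d : fseries C) :=
  forall k, is_cderive (fun s => a s k) x (d k).

Lemma is_sderive_deg N a x d :
  (forall s, deg_le N (a s)) -> is_sderive a x d -> deg_le N d.
Proof.
move=> Na ad k Nk; apply: is_cderive_uniq (ad k) _.
have -> : (fun s => a s k) = (fun=> 0) by apply/funext => s; exact: Na.
exact: is_cderive_cst.
Qed.

(** Uniform degree bounds make each coefficient of the product a finite sum with
    a range that does not vary with the parameter. *)
Lemma is_sderiveM N M a b x d e :
  (forall s, deg_le N (a s)) -> (forall s, deg_le M (b s)) ->
  is_sderive a x d -> is_sderive b x e ->
  is_sderive (fun s => a s ** b s) x (d ** b x + a x ** e).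
Proof.
move=> Na Mb ad be k.
have Nd := is_sderive_deg Na ad; have Me := is_sderive_deg Mb be.
rewrite -[(_ + _ : fseries C) k]/((d ** b x) k + (a x ** e) k).
have [[n ->]|H] := degP (N + M) k; last first.
  have -> : (fun s => (a s ** b s) k) = (fun=> 0).
    by apply/funext => s; exact: (deg_leM (Na s) (Mb s)).
  rewrite (deg_leM Nd (Mb x)) // (deg_leM (Na x) Me) // addr0.
  exact: is_cderive_cst.
have -> : (fun s => (a s ** b s) (N + M - n%:Z)) =
    (fun s => \sum_(i < n.+1) a s (N - i%:Z) * b s (M - (n - i)%N%:Z)).
  by apply/funext => s; exact: smul_degE.
rewrite !smul_degE // -big_split; apply: is_cderive_sum => i.
exact: is_cderiveM.
Qed.

Lemma is_sderiveX (G : R -> linf C) x (G' : linf C) n :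
  (forall s, deg_le 1 (lval (G s))) -> is_sderive (fun s => lval (G s)) x (lval G') ->
  is_sderive (fun s => spow (lval (G s)) n.+1) x (lval (n.+1%:R * G x ^+ n * G')).
Proof.
move=> G1 HG; elim: n => [|n IH].
  have -> : (fun s => spow (lval (G s)) 1) = (fun s => lval (G s)).
    by apply/funext => s; rewrite -lvalX expr1.
  by rewrite expr0 mul1r mul1r.
have -> : lval (n.+2%:R * G x ^+ n.+1 * G') =
    lval G' ** spow (lval (G x)) n.+1
    + lval (G x) ** lval (n.+1%:R * G x ^+ n * G').
  rewrite -lvalX -!lvalM -[RHS]/(lval (_ + _)) exprS [n.+2%:R]mulrS; congr lval; ring.
apply: (is_sderiveM (M := n.+1%:Z) G1 _ HG IH) => s.
by rewrite -lvalX; have := degX (n := n.+1) (G1 s); rewrite mul1r.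
Qed.

(** The coefficients of a reciprocal are determined one after the other by the
    previous ones, hence are differentiable as well. *)
Lemma is_sderive_inv (G H : R -> linf C) x (G' : linf C) :
  (forall s, G s * H s = 1) ->
  (forall s, deg_le 1 (lval (G s))) -> (forall s, deg_le (-1) (lval (H s))) ->
  is_sderive (fun s => lval (G s)) x (lval G') ->
  (exists d, is_cderive (fun s => lval (H s) (-1)) x d) ->
  exists H' : linf C, [/\ is_sderive (fun s => lval (H s)) x (lval H')
    & G' * H x + G x * H' = 0].
Proof.
move=> GH G1 H1 HG [d0 Hd0].
have lead s : lval (H s) (-1) * lval (G s) 1 = 1.
  by rewrite mulrC -(lval_lead (G1 s) (H1 s)) GH.
have coefE s (k : nat) : lval (H s) (-1 - k.+1%:Z) =
    - (lval (H s) (-1) *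
       \sum_(i < k.+1) lval (G s) (1 - i.+1%:Z) * lval (H s) (-1 - (k - i)%N%:Z)).
  have := smul_degE k.+1 (G1 s) (H1 s); rewrite -lvalM GH.
  have -> : lval (1 : linf C) (1 + -1 - k.+1%:Z) = 0.
    by rewrite -mono1 lval_mono; case: eqP => //; lia.
  rewrite big_ord_recl /= subr0 subn0 => /esym/eqP.
  rewrite addr_eq0 => /eqP E.
  rewrite -[LHS]mul1r -(lead s) -mulrA E mulrN; congr (- (_ * _)).
have ex (k : nat) : exists d, is_cderive (fun s => lval (H s) (-1 - k%:Z)) x d.
  elim/ltn_ind: k => -[_|k IH]; first by exists d0; rewrite subr0.
  have /choice[e He] : forall i : 'I_k.+1, exists e,
      is_cderive (fun s => lval (H s) (-1 - (k - i)%N%:Z)) x e.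
    by move=> i; apply: IH; lia.
  have -> : (fun s => lval (H s) (-1 - k.+1%:Z)) =
     (fun s => (-1) * (lval (H s) (-1) *
       \sum_(i < k.+1) lval (G s) (1 - i.+1%:Z) * lval (H s) (-1 - (k - i)%N%:Z))).
    by apply/funext => s; rewrite coefE mulN1r.
  eexists; apply: is_cderiveM; first exact: is_cderive_cst.
  apply: is_cderiveM; first exact: Hd0.
  apply: is_cderive_sum => i; apply: is_cderiveM; first exact: HG.
  exact: He.
have /choice[e He] : forall k : int, exists d, is_cderive (fun s => lval (H s) k) x d.
  move=> k; have [[n ->]|Hk] := degP (-1) k; first exact: ex.
  exists 0; have -> : (fun s => lval (H s) k) = (fun=> 0).
    by apply/funext => s; exact: H1.
  exact: is_cderive_cst.
have e1 : deg_le (-1) e := is_sderive_deg H1 He.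
exists (mk e1); split => //; apply: linfE => k.
have D := is_sderiveM G1 H1 HG He k.
apply: is_cderive_uniq D _.
have -> : (fun s => (lval (G s) ** lval (H s)) k) = (fun=> lval 1 k).
  by apply/funext => s; rewrite -lvalM GH.
exact: is_cderive_cst.
Qed.

Lemma tshift0 (t : int -> C) n : tshift t n 0 = t.
Proof.
apply/funext => k; rewrite /tshift; case: ifP => _; first by rewrite addr0.
by rewrite rmorph0 subr0 if_same.
Qed.

(** As lambda is real-valued, the chain rule holds for the real partial
    derivatives, and the Wirtinger derivatives are C-linear in these. *)
Lemma tderive_chain n (h : R -> C) (lam : (int -> C) -> R) t d :
  is_cderive h (lam t) d -> tderivable n (fun t' => (lam t')%:C) t ->
  tderivable n (fun t' => h (lam t')) t /\
  tderive n (fun t' => h (lam t')) t = tderive n (fun t' => (lam t')%:C) t * d.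
Proof.
move=> hd [Hx Hy].
have chain (c : R -> int -> C) : c 0 = t ->
    cderivable (fun s => (lam (c s))%:C) 0 ->
    is_cderive (fun s => h (lam (c s))) 0
      (cderive (fun s => (lam (c s))%:C) 0 * d).
  move=> c0 [Hc _].
  have /is_cderive_real/is_cderiveP[_ ->] := derivableP Hc.
  by apply: (is_cderive_comp (f := lam \o c)); [rewrite /= c0 | exact: derivableP].
have X (m : nat) : cderivable (along_x (fun t' => (lam t')%:C) t m) 0 ->
    is_cderive (along_x (fun t' => h (lam t')) t m) 0
      (dx m (fun t' => (lam t')%:C) t * d).
  by apply: (chain (fun s => tshift t m (s +i* 0))); exact: tshift0.
have Y (m : nat) : cderivable (along_y (fun t' => (lam t')%:C) t m) 0 ->
    is_cderive (along_y (fun t' => h (lam t')) t m) 0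
      (dy m (fun t' => (lam t')%:C) t * d).
  by apply: (chain (fun s => tshift t m (0 +i* s))); exact: tshift0.
have [cx dxE] := is_cderiveP (X _ Hx).
split; first by split; [exact: cx | move=> n0; have [] := is_cderiveP (Y _ (Hy n0))].
case: n Hx Hy cx dxE => [[|n]|n] Hx Hy cx dxE; first exact: dxE.
  have [_ dyE] := is_cderiveP (Y _ (Hy isT)).
  rewrite /tderive -/(dx _ _ _) in dxE dyE *.
  rewrite [dx _ _ _ in LHS]dxE [dy _ _ _ in LHS]dyE; ring.
have [_ dyE] := is_cderiveP (Y _ (Hy isT)).
rewrite /tderive [dx _ _ _ in LHS]dxE [dy _ _ _ in LHS]dyE; ring.
Qed.

End Derivatives.

(** * From the Loewner relation to the Toda equations *)

Section Toda.
Variable R : realType.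
Local Notation C := R[i].

Definition cj (a : fseries C) : fseries C := fun k => (a k)^*.

Lemma cj_smul a b N M : deg_le N a -> deg_le M b -> cj (a ** b) = cj a ** cj b.
Proof.
move=> Na Mb; apply/funext => k; rewrite /cj.
have cNa : deg_le N (cj a) by move=> i Hi; rewrite /cj Na ?rmorph0.
have cMb : deg_le M (cj b) by move=> i Hi; rewrite /cj Mb ?rmorph0.
have [[n ->]|H] := degP (N + M) k; last first.
  by rewrite (deg_leM Na Mb) ?(deg_leM cNa cMb) ?rmorph0.
rewrite !smul_degE // rmorph_sum; apply: eq_bigr => i _; exact: rmorphM.
Qed.

Lemma cj1 : cj sone = sone.
Proof.
apply/funext => k; rewrite /cj /sone /smonom.
by case: ifP; rewrite ?rmorph1 ?rmorph0.
Qed.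

Lemma cjX a N n : deg_le N a -> cj (spow a n) = spow (cj a) n.
Proof.
move=> Na; elim: n => [|n IH]; first exact: cj1.
have aX : exists M, deg_le M (spow a n).
  by exists (N * n%:Z); rewrite -[a]/(lval (mk Na)) -lvalX; exact: degX.
by have [M Ma] := aX; rewrite /= (cj_smul Na Ma) IH.
Qed.

Lemma loewner_rel_cj (p s x : C) (q d : fseries C) : p^* = p ->
  loewner_rel p s x q d -> loewner_rel p s^* x^* (cj q) (cj d).
Proof.
move=> pp H k; have := congr1 Num.conj (H k).
have conj_if (c : bool) : (if c then x else 0)^* = if c then x^* else 0.
  by case: c; rewrite ?rmorph0.
rewrite !(rmorphB, rmorphD, rmorphM, rmorphN) /= pp !rmorph_int !conj_if /cj.
exact.
Qed.

Lemma upper_near_zero (a : fseries C) : near_zero (upper_part a).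
Proof. by exists 0 => k k0; rewrite upper_partE; case: ltrgtP k0. Qed.

Lemma upper_near_infty (a : fseries C) (n : nat) :
  deg_le n a -> near_infty (upper_part a).
Proof.
move=> na; exists n => k nk; rewrite upper_partE na ?mulr0 ?if_same //.
Qed.

Lemma cj_near_zero (a : fseries C) : near_zero a -> near_zero (cj a).
Proof. by case=> N Na; exists N => k kN; rewrite /cj Na ?rmorph0. Qed.

Lemma cj_near_infty (a : fseries C) : near_infty a -> near_infty (cj a).
Proof. by case=> N Na; exists N => k kN; rewrite /cj Na ?rmorph0. Qed.

Lemma lower_partE (a : fseries C) :
  rf (cj (upper_part a)) = strunc (fun k => k < 0) (rf (cj a))
    + 2^-1 *: strunc (fun k => k == 0) (rf (cj a)).
Proof.
apply/funext => k.
rewrite -[RHS]/(strunc _ (rf (cj a)) k + 2^-1 * strunc _ (rf (cj a)) k).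
rewrite /rf /cj upper_partE /strunc oppr_gt0 oppr_eq0.
case: (ltrgtP k 0) => _; rewrite ?mulr0 ?addr0 ?add0r ?rmorph0 //.
by rewrite rmorphM fmorphV rmorph_nat.
Qed.

Lemma is_sderive_cj (a : R -> fseries C) x d :
  is_sderive a x d -> is_sderive (fun s => cj (a s)) x (cj d).
Proof. by move=> ad k; apply: is_cderive_conj. Qed.

Lemma is_sderive_rf (a : R -> fseries C) x d :
  is_sderive a x d -> is_sderive (fun s => rf (a s)) x (rf d).
Proof. by move=> ad k; apply: ad. Qed.

Lemma is_sderive_upper (a : R -> fseries C) x d :
  is_sderive a x d -> is_sderive (fun s => upper_part (a s)) x (upper_part d).
Proof.
move=> ad k; rewrite upper_partE.
have -> : (fun s => upper_part (a s) k) = (fun s => if 0 < k then a s k else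
    if k == 0 then 2^-1 * a s k else 0).
  by apply/funext => s; rewrite upper_partE.
case: ifP => _; first exact: ad.
case: ifP => _; last exact: is_cderive_cst.
by have := is_cderiveM (is_cderive_cst 2^-1 x) (ad k); rewrite mul0r add0r.
Qed.

Lemma smulZl (c : C) (a b : fseries C) :
  (fun k => c * a k) ** b = (fun k => c * (a ** b) k).
Proof.
apply/funext => k; rewrite /smul mulr_fsumr.
by apply: eq_fsbigr => i _; rewrite mulrA.
Qed.

Lemma smulZr (c : C) (a b : fseries C) :
  a ** (fun k => c * b k) = (fun k => c * (a ** b) k).
Proof.
apply/funext => k; rewrite /smul mulr_fsumr.
by apply: eq_fsbigr => i _; rewrite mulrCA.
Qed.

(** All derivatives are multiples of that of lambda in t_0, by the chain rule and
    the equation satisfied by lambda; this factor comes out of the bracket. *)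
Lemma toda_equation (lam : (int -> C) -> R) t (n : int) (b M : R -> fseries C)
    (d M' : fseries C) (x : C) :
  is_sderive b (lam t) d -> is_sderive M (lam t) M' ->
  (forall m, tderivable m (fun t' => (lam t')%:C) t) ->
  tderive n (fun t' => (lam t')%:C) t = x * tderive 0 (fun t' => (lam t')%:C) t ->
  seuler (b (lam t)) ** M' - d ** seuler (M (lam t)) = (fun k => x * M' k) ->
  stderive n (fun t' => M (lam t')) t =
  toda_bracket (fun t' => b (lam t')) (fun t' => M (lam t')) t.
Proof.
move=> bd MM' Hlam Hn E.
have chain (a : R -> fseries C) a' m : is_sderive a (lam t) a' ->
    stderive m (fun t' => a (lam t')) t =
    (fun k => tderive m (fun t' => (lam t')%:C) t * a' k).
  by move=> aa'; apply/funext => k; have [_] := tderive_chain (aa' k) (Hlam m).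
rewrite /toda_bracket !(chain _ _ _ MM') (chain _ _ _ bd) smulZl smulZr Hn.
apply/funext => k; set c := tderive 0 _ t.
have Ek : (seuler (b (lam t)) ** M') k - (d ** seuler (M (lam t))) k = x * M' k.
  exact: (congr1 (fun a : fseries C => a k) E).
rewrite -[RHS]/(c * (seuler (b (lam t)) ** M') k - c * (d ** seuler (M (lam t))) k).
by rewrite -mulrBr Ek; ring.
Qed.

End Toda.

Theorem proposition5p11 (R : realType) (I : set R)
    (phi : R -> R) (u : R -> nat -> R[i]) (sigma : R -> R[i])
    (g f : R -> fseries R[i]) (Phi Psi : R -> nat -> {poly R[i]})
    (U : set (int -> R[i])) (lambda : (int -> R[i]) -> R) :
  let r := fun l => (expR (phi l))%:C in
  let G := fun l => laurent (r l) (u l) in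
  let F := fun l => sinv near_zero (sreflect (G l)) in
  open I ->
  (forall l, I l -> `|sigma l| = 1) ->
  loewner_solution I phi sigma G ->
  (forall l, I l -> inverse_infty (r l) (G l) (g l)) ->
  (forall l, I l -> inverse_zero (r l) (F l) (f l)) ->
  (forall l, I l -> faber_infty (r l) (g l) (Phi l)) ->
  (forall l, I l -> faber_zero (r l) (f l) (Psi l)) ->
  U `<=` @real_times R ->
  (forall t, U t -> I (lambda t)) ->
  (forall t n, U t ->
    tderivable n (fun t' => (lambda t')%:C) t /\
    tderive n (fun t' => (lambda t')%:C) t =
      xi (sigma (lambda t)) (Phi (lambda t)) (Psi (lambda t)) n
      * tderive 0 (fun t' => (lambda t')%:C) t) ->
  dtoda_solution U (fun t => G (lambda t)) (fun t => F (lambda t)).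
Proof.
move=> r G F _ sigma1 loewner invG invF faberG faberF _ UI Hlam.
have r_neq0 l : r l != 0 by rewrite /r (fmorph_eq0 (real_complex R)) gt_eqF ?expR_gt0.
have r_conj l : (r l)^* = r l by exact: conjc_real.
have G1 l : deg_le 1 (G l).
  move=> k k1; rewrite /G /laurent; case: eqP => [|_]; first lia.
  by case: ifP => //; lia.
have cG1 l : deg_le 1 (cj (G l)) by move=> k k1; rewrite /cj (G1 l) ?rmorph0.
pose lG l := mk (G1 l); pose lcG l := mk (cG1 l).
have Glead l : G l 1 = r l by [].
have /choice[lGi lGiP] : forall l, exists H : linf R[i],
    lG l * H = 1 /\ deg_le (-1) (lval H).
  by move=> l; apply: (@inv_exists _ (lG l) 1 (r l)^-1 (G1 l)); rewrite /= Glead mulVf.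
have /choice[H HP] : forall l, exists H : linf R[i],
    lcG l * H = 1 /\ deg_le (-1) (lval H).
  move=> l; apply: (@inv_exists _ (lcG l) 1 (r l)^-1 (cG1 l)).
  by rewrite /= /cj Glead r_conj mulVf.
have cGH l : lcG l * H l = 1 by have [] := HP l.
have H1 l : deg_le (-1) (lval (H l)) by have [] := HP l.
have reflG l : rf (sreflect (G l)) = lval (lcG l).
  by apply/funext => k; rewrite /rf /sreflect opprK.
have FE l : F l = rf (lval (H l)) := sinv_zero_rf (reflG l) (cGH l).
have rfF l : rf (F l) = lval (H l) by rewrite FE rfK.
have FiE l : sinv near_zero (F l) = sreflect (G l).
  by rewrite (sinv_zero_rf (rfF l) (H := lcG l)) // mulrC.
have F0 l : near_zero (F l) by apply/near_rf; rewrite rfF; exact: lvalP.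
(* G and F solve the Loewner relation with the same sigma: conjugation
   replaces sigma by 1 / sigma, and the reflection between 0 and oo undoes this. *)
have data l : I l -> exists G' F' : fseries R[i],
    [/\ is_sderive G l G', is_sderive F l F',
        near_zero F' & deg_le 1 G'] /\
    [/\ loewner_rel (derive1 phi l)%:C (sigma l) 0 (G l) G',
        loewner_rel (derive1 phi l)%:C (sigma l) 0 (F l) F' &
        sigma l * (sigma l)^* = 1].
  move=> Il; have [phid Gd GE] := loewner l Il.
  have ss : sigma l * (sigma l)^* = 1 by rewrite -normCK sigma1 ?expr1n.
  pose G' : fseries R[i] := fun k => cderive (fun l' => G l' k) l.
  have GG' : is_sderive G l G' by move=> k; exact: cderivableP.
  have G'1 : deg_le 1 G' := is_sderive_deg G1 GG'.
  have cG'1 : deg_le 1 (cj G') by move=> k k1; rewrite /cj G'1 ?rmorph0.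
  have relG : loewner_rel (derive1 phi l)%:C (sigma l) 0 (G l) G'.
    by rewrite /G' GE; exact: (loewner_kernel_rel _ _ (lG l)).
  have pp : ((derive1 phi l)%:C)^* = (derive1 phi l)%:C.
    by exact: conjc_real.
  have relcG := loewner_rel_cj pp relG; rewrite rmorph0 in relcG.
  have [] := @is_sderive_inv R lcG H l (mk cG'1) cGH cG1 H1.
  - exact: is_sderive_cj.
  - have -> : (fun s => lval (H s) (-1)) = (fun s => (expR (- phi s))%:C).
      apply/funext => s; apply: (mulfI (r_neq0 s)).
      have := lval_lead (cG1 s : deg_le 1 (lval (lcG s))) (H1 s).
      rewrite cGH /= /cj Glead r_conj => <-.
      by rewrite /r -(rmorphM (real_complex R)) -expRD [phi s - _]subrr expR0.
    have /derivableP phi' := phid.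
    by eexists; apply: is_cderive_real.
  move=> H' [HH' GH'].
  exists G', (rf (lval H')); split; split => //.
  - have -> : F = (fun s => rf (lval (H s))) by apply/funext => s; exact: FE.
    exact: is_sderive_rf.
  - by apply/near_rf; rewrite rfK; exact: lvalP.
  - have ss' : (sigma l)^* * sigma l = 1 by rewrite mulrC.
    have := loewner_rel_rf ss' (loewner_inv (cGH l) GH' relcG).
    by rewrite oppr0 FE.
split.
- exists (fun t => r (lambda t)), (fun t => u (lambda t)),
    (fun t n => (u (lambda t) n)^*) => t Ut; split => //.
  rewrite FiE; apply/funext => k; rewrite /sreflect /G /laurent.
  case: eqP => _; first exact: r_conj.
  by case: ifP => _; rewrite ?rmorph0.
- move=> t n Ut; have [G' [F' [[GG' FF' _ _] _]]] := data _ (UI t Ut).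
  have [lamd _] := Hlam t n Ut.
  by split=> k; [have [] := tderive_chain (GG' k) lamd | have [] := tderive_chain (FF' k) lamd].
move=> t n Ut n0; have Il := UI t Ut; set l := lambda t.
have [G' [F' [[GG' FF' F'0 G'1] [relG relF ss]]]] := data _ Il.
have Gi : near_infty (G l) by exists 1; exact: G1.
have G'i : near_infty G' by exists 1; exact: G'1.
have s0 : sigma l != 0.
  by apply/eqP => s0; move/eqP: ss; rewrite s0 mul0r eq_sym oner_eq0.
have sV : (sigma l)^-1 = (sigma l)^*.
  by rewrite -[RHS]mul1r -(mulVf s0) -mulrA ss mulr1.
have pp : ((derive1 phi l)%:C)^* = (derive1 phi l)%:C by exact: conjc_real.
case: n n0 => // n n0.
pose dX := lval (n.+1%:R * lG l ^+ n * mk G'1).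
(* The Hamiltonians are b for the times t_n and b' for the times t_(-n). *)
have GX : is_sderive (fun s => spow (G s) n.+1) l dX := @is_sderiveX R lG l (mk G'1) n G1 GG'.
have X1 s : deg_le n.+1 (spow (G s) n.+1).
  rewrite -[G s]/(lval (lG s)) -lvalX.
  by have := degX (n := n.+1) (G1 s : deg_le 1 (lval (lG s))); rewrite mul1r.
have dX1 : deg_le n.+1 dX := is_sderive_deg X1 GX.
have relX : loewner_rel (derive1 phi l)%:C (sigma l) 0 (spow (G l) n.+1) dX.
  rewrite -[G l]/(lval (lG l)) -lvalX; exact: loewner_pow.
pose b s := upper_part (spow (G s) n.+1).
pose b' s := rf (cj (b s)).
have bd : is_sderive b l (upper_part dX) by exact: is_sderive_upper.
have b'd : is_sderive b' l (rf (cj (upper_part dX))).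
  exact/is_sderive_rf/is_sderive_cj.
have relb := loewner_upper (X1 l) dX1 relX.
set x := \sum_(m < _) _ in relb.
have relb' : loewner_rel (derive1 phi l)%:C (sigma l) (- x^*) (b' l)
    (rf (cj (upper_part dX))).
  by apply: loewner_rel_rf (loewner_rel_cj pp relb); rewrite mulrC.
have [g1 gdeg _ gG] := invG l Il; have [f1 fdeg _ fF] := invF l Il.
have [GGi Gi1] := lGiP l.
have PhiE := @faber_inftyE _ _ _ GGi (G1 l) Gi1 (r l) (r_neq0 l)
  (mk (gdeg : deg_le 1 (g l))) (Phi l) gdeg g1 gG (faberG l Il) n.+1 n0.
have rf1 : deg_le (-1) (rf (f l)) by move=> k k1; rewrite /rf fdeg //; lia.
have PsiE : Psi l n.+1 = \poly_(m < n.+2) lval (lcG l ^+ n.+1) m%:Z.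
  apply: (@faber_zeroE _ _ _ (cGH l) (cG1 l) (H1 l) (r l) (r_neq0 l)
    (mk rf1) (Psi l) rf1 _ _ _ n.+1 n0) => //.
    rewrite (scomp_zero_rf _ (rfF l) (cGH l)) ?fF ?rf_monom // => k k0.
    by apply: fdeg; lia.
  by rewrite rfK; exact: (faberF l Il).
have xiE : xi (sigma l) (Phi l) (Psi l) n.+1%:Z = x.
  rewrite (xi_pos _ _ n0 PhiE); apply: eq_bigr => m _.
  by rewrite lvalX.
have xiNE : xi (sigma l) (Phi l) (Psi l) (- n.+1%:Z) = - x^*.
  rewrite (xi_neg _ n0 s0 PsiE) sV rmorph_sum; congr (- _); apply: eq_bigr => m _.
  rewrite !rmorphM rmorphXn rmorph_nat lvalX.
  by rewrite -[lval (lcG l)]/(cj (G l)) -(cjX _ (G1 l)).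
have lamd m := (Hlam t m Ut).1.
have lam1 := (Hlam t n.+1%:Z Ut).2; rewrite -/l xiE in lam1.
have lam2 := (Hlam t (- n.+1%:Z) Ut).2; rewrite -/l xiNE in lam2.
have BtE : toda_Bt n.+1 (fun t => F (lambda t)) = (fun t => b' (lambda t)).
  apply/funext => t'; rewrite /toda_Bt FiE /b' /b lower_partE (cjX _ (G1 _)) rfX //.
have bi := upper_near_infty (X1 l); have b0 := upper_near_zero (spow (G l) n.+1).
have di := upper_near_infty dX1; have d0 := upper_near_zero dX.
have rf_zi (a : fseries R[i]) : near_zero a -> near_infty (rf (cj a)).
  by move=> /cj_near_zero /near_rf.
have rf_iz (a : fseries R[i]) : near_infty a -> near_zero (rf (cj a)).
  by move=> /cj_near_infty ai; apply/near_rf; rewrite rfK.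
rewrite BtE.
split.
- apply: (toda_equation bd GG' lamd lam1).
  exact: (loewner_bracket_infty bi di Gi G'i relb relG).
- apply: (toda_equation b'd GG' lamd lam2).
  exact: (loewner_bracket_infty (rf_zi _ b0) (rf_zi _ d0) Gi G'i relb' relG).
- apply: (toda_equation bd FF' lamd lam1).
  exact: (loewner_bracket_zero s0 b0 d0 (F0 l) F'0 relb relF).
- apply: (toda_equation b'd FF' lamd lam2).
  exact: (loewner_bracket_zero s0 (rf_iz _ bi) (rf_iz _ di) (F0 l) F'0 relb' relF).
Qed.
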